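(* Every fine surface $M$ homeomorphic to a closed disk that fills isometrically a fine cycle $C=C_{a,b}$ has $\mathrm{Area}(M)\geq 2ab-a-b$.
   Context: A fine metric on a graph $G$ is an assignment of lengths to directed edges such that, for each undirected edge, one of its two directed versions has length $1$ and the other has length $0$; equivalently, it is an orientation of the edges, where traversing an edge forward costs $1$ and traversing it backward costs $0$. The length of a directed path or cycle is the sum of the lengths of its directed edges, and $d(x,y)$ is the minimum length of a path from $x$ to $y$ (in general $d(x,y)\neq d(y,x)$, and $d(x,y)=0$ is possible for $x\ne y$). A fine triangle is a triangle whose three edges are oriented acyclically (equivalently, its vertices are totally ordered and each edge points from the smaller to the larger vertex). A fine surface is a combinatorial surface made of finitely many fine triangles glued side to side, respecting the orientations of the edges; its 1-skeleton carries the resulting fine metric, which defines the distance $d_M$ on the set of vertices. Its area is the number of fine triangles. A fine cycle $C_{a,b}$ is a cycle graph $C$ with a fine metric such that the length of $C$ traversed in one direction is $a$ and its length traversed in the opposite direction is $b$ (so $C$ has $a+b$ edges). $M$ fills $C$ isometrically if $\partial M=C$ (as graphs with fine metric) and $d_M(x,y)=d_C(x,y)$ for all vertices $x,y$ of $C$, where $d_C$ is the distance along $C$. *)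

(* Defs.v *)
From Stdlib Require Import Relation_Operators.
From mathcomp Require Import all_boot all_order all_algebra.
From mathcomp Require Import all_classical all_reals all_analysis.
Set Implicit Arguments.
Unset Strict Implicit.
Unset Printing Implicit Defensive.
Import Order.TTheory GRing.Theory Num.Theory.
Import numFieldNormedType.Exports.
Local Open Scope ring_scope.
Local Open Scope classical_set_scope.
Local Open Scope quotient_scope.

(* A graph with a fine metric, given as an oriented multigraph: the dart
   (e, true) runs from [src e] to [tgt e] and has length 1, the dart (e, false)
   runs backwards and has length 0. *)
Record fine_graph := FineGraph {
  vertex : Type;
  edge : Type;
  src : edge -> vertex;
  tgt : edge -> vertex
}.

Definition dart (G : fine_graph) : Type := (edge G * bool)%type.

Definition dart_src (G : fine_graph) (d : dart G) : vertex G :=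
  if d.2 then src d.1 else tgt d.1.

Definition dart_tgt (G : fine_graph) (d : dart G) : vertex G :=
  if d.2 then tgt d.1 else src d.1.

Definition dart_rev (G : fine_graph) (d : dart G) : dart G := (d.1, ~~ d.2).

Definition dart_length (G : fine_graph) (d : dart G) : nat :=
  if d.2 then 1 else 0.

Fixpoint is_walk (G : fine_graph) (x : vertex G) (p : seq (dart G))
    (y : vertex G) : Prop :=
  if p is d :: p' then x = dart_src d /\ is_walk (dart_tgt d) p' y else x = y.

Definition walk_length (G : fine_graph) (p : seq (dart G)) : nat :=
  (\sum_(d <- p) dart_length d)%N.

Definition connected_by (G : fine_graph) (x y : vertex G) (k : nat) : Prop :=
  exists2 p, is_walk x p y & walk_length p = k.

(* [None] when there is no walk from x to y. *)
Definition dist (G : fine_graph) (x y : vertex G) : option nat :=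
  if pselect (exists k, `[< connected_by x y k >]) is left ex
  then Some (ex_minn ex) else None.

(* The cycle graph with vertices 0, ..., n-1, whose i-th edge joins i to
   i + 1 mod n and is oriented in that direction iff [o i]. *)
Definition cycle_graph (n : nat) (o : 'I_n -> bool) : fine_graph :=
  @FineGraph 'I_n 'I_n (fun i => if o i then i else ordS i)
                       (fun i => if o i then ordS i else i).

Definition cycle_walk (n : nat) (o : 'I_n -> bool) :
  seq (dart (cycle_graph o)) := [seq (i, o i) | i <- enum 'I_n].

Definition cycle_rev_walk (n : nat) (o : 'I_n -> bool) :
  seq (dart (cycle_graph o)) := rev (map (@dart_rev _) (cycle_walk o)).

Definition is_fine_cycle (a b n : nat) (o : 'I_n -> bool) : Prop :=
  [/\ (0 < n)%N, walk_length (cycle_walk o) = a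
    & walk_length (cycle_rev_walk o) = b].

(* Every triangle has vertices 0 < 1 < 2; its side i is the one opposite to
   vertex i, oriented from its smaller to its larger vertex.  The involution
   [glue] pairs the sides that are glued to each other, by the unique affine map
   that respects the orientations; its fixed points are the unglued sides. *)
Record fine_surface := FineSurface {
  triangle : finType;
  glue : triangle * 'I_3 -> triangle * 'I_3;
  glueK : involutive glue
}.

Definition area (M : fine_surface) : nat := #|triangle M|.

Section Skeleton.
Variable M : fine_surface.

Definition corner : finType := (triangle M * 'I_3)%type.
Definition side : finType := (triangle M * 'I_3)%type.

(* k = 0 is the source of the side and k = 1 its target. *)
Definition side_end (s : side) (k : 'I_2) : corner := (s.1, lift s.2 k).

Definition corner_glue : rel corner := fun c c' =>
  [exists s : side, exists k : 'I_2,
    (c == side_end s k) && (c' == side_end (glue s) k)].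

Lemma corner_glue_sym : symmetric corner_glue.
Proof.
have H c c' : corner_glue c c' -> corner_glue c' c.
  move=> /existsP[s /existsP[k /andP[cE c'E]]].
  apply/existsP; exists (glue s); apply/existsP; exists k.
  by rewrite glueK cE c'E.
by move=> c c'; apply/idP/idP; apply: H.
Qed.

Definition corner_eqv : rel corner := connect corner_glue.

Canonical corner_equiv_rel : equiv_rel corner :=
  EquivRel corner_eqv (@connect0 _ corner_glue)
    (sym_connect_sym corner_glue_sym) (@connect_trans _ corner_glue).

Definition side_eqv : rel side := fun s s' => (s' == s) || (s' == glue s).

Lemma side_eqv_refl : reflexive side_eqv.
Proof. by move=> s; rewrite /side_eqv eqxx. Qed.

Lemma side_eqv_sym : symmetric side_eqv.
Proof.
move=> s s'; rewrite /side_eqv eq_sym; congr orb.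
by apply/eqP/eqP => ->; rewrite glueK.
Qed.

Lemma side_eqv_trans : transitive side_eqv.
Proof.
rewrite /side_eqv => s2 s1 s3 /orP[]/eqP-> // /orP[]/eqP->.
  by rewrite eqxx orbT.
by rewrite glueK eqxx.
Qed.

Canonical side_equiv_rel : equiv_rel side :=
  EquivRel side_eqv side_eqv_refl side_eqv_sym side_eqv_trans.

(* The end points do not depend on the representative of the edge, by
   definition of [corner_eqv]. *)
Definition skeleton : fine_graph :=
  @FineGraph {eq_quot corner_eqv} {eq_quot side_eqv}
    (fun e => \pi_{eq_quot corner_eqv} (side_end (repr e) ord0))
    (fun e => \pi_{eq_quot corner_eqv} (side_end (repr e) ord_max)).

Definition boundary_edge (e : edge skeleton) : Prop :=
  exists2 s : side, e = \pi_{eq_quot side_eqv} s & glue s = s.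

Definition boundary_vertex (v : vertex skeleton) : Prop :=
  exists2 e, boundary_edge e & v = src e \/ v = tgt e.

(* [fV] and [fE] form an isomorphism of oriented graphs from C onto the
   subgraph of the 1-skeleton consisting of the boundary vertices and edges. *)
Definition boundary_iso (C : fine_graph) (fV : vertex C -> vertex skeleton)
    (fE : edge C -> edge skeleton) : Prop :=
  [/\ injective fV /\ (forall v, boundary_vertex v <-> exists x, fV x = v),
      injective fE /\ (forall e, boundary_edge e <-> exists c, fE c = e)
    & forall c, src (fE c) = fV (src c) /\ tgt (fE c) = fV (tgt c)].

Definition fills_isometrically (C : fine_graph) : Prop :=
  exists fV fE, @boundary_iso C fV fE /\
    forall x y : vertex C, dist (fV x) (fV y) = dist x y.

End Skeleton.

Section Realization.
Variables (R : realType) (M : fine_surface).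

(* Barycentric coordinates. *)
Definition simplex : set 'rV[R]_3 :=
  [set x | (forall i, 0 <= x ord0 i) /\ \sum_i x ord0 i = 1].

Definition triangles : topologicalType := {t : triangle M & set_type simplex}.

Definition coord (p : triangles) (i : 'I_3) : R := \val (tagged p) ord0 i.

Definition point_glue (p q : triangles) : Prop :=
  exists s : side M,
    [/\ tag p = s.1, coord p s.2 = 0, tag q = (glue s).1,
        coord q (glue s).2 = 0
      & forall k : 'I_2, coord p (lift s.2 k) = coord q (lift (glue s).2 k)].

Definition point_eqv : rel triangles :=
  fun p q => `[< clos_refl_sym_trans triangles point_glue p q >].

Lemma point_eqv_refl : reflexive point_eqv.
Proof. by move=> p; apply/asboolP; apply: rst_refl. Qed.

Lemma point_eqv_sym : symmetric point_eqv.
Proof. by move=> p q; apply/asboolP/asboolP; apply: rst_sym. Qed.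

Lemma point_eqv_trans : transitive point_eqv.
Proof.
move=> q p r /asboolP pq /asboolP qr; apply/asboolP.
exact: rst_trans pq qr.
Qed.

Canonical point_equiv_rel : equiv_rel triangles :=
  EquivRel point_eqv point_eqv_refl point_eqv_sym point_eqv_trans.

Definition realization : topologicalType :=
  quotient_topology {eq_quot point_eqv}.

End Realization.

Definition closed_disk (R : realType) : topologicalType :=
  set_type [set p : R * R | p.1 ^+ 2 + p.2 ^+ 2 <= 1].

Definition homeomorphic (X Y : topologicalType) : Prop :=
  exists (f : X -> Y) (g : Y -> X),
    [/\ continuous f, continuous g, cancel f g & cancel g f].

(* Main.v *)
Require Import Defs.
From mathcomp Require Import all_boot all_order all_algebra.
From mathcomp Require Import all_classical all_reals all_analysis.
From Stdlib Require Import Relation_Operators.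
From mathcomp Require Import ring lra zify.
Import Order.TTheory GRing.Theory Num.Theory.
Import numFieldNormedType.Exports.
Import Defs.
Local Open Scope ring_scope.

Set Implicit Arguments.
Unset Strict Implicit.
Unset Printing Implicit Defensive.
Local Open Scope classical_set_scope.
Local Open Scope quotient_scope.

                                              

(** For each boundary vertex i let F_i(v) be the distance from i to v. The pair (F_i, F_{i+1}) maps
    the surface to the plane, and twice the signed area of the image can be computed on the
    triangles or, by the discrete Stokes formula [stokes], along the boundary. Summed over the
    cycle, the boundary side involves only distances between vertices of C. These are distances
    along C because the filling is isometric, and [cycle_boundary_sum] evaluates the sum to 2ab - a
    - b. It remains to see that each triangle contributes at most 1 in absolute value
    ([boundary_sum_le_area]).

    On a triangle with vertices 0 < 1 < 2 the function F_i grows by 0 or 1 along every edge, so its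
    increments (B i, D i) along 01 and 12 are (0,0), (1,0) or (0,1). The triangle contributes the
    sum over i of the determinants of consecutive increments, that is, the winding number of a
    closed polygon whose vertices are among these three points. By [winding_le1] it is at most 1 in
    absolute value once the i with D i form a cyclic interval. Planarity gives this: if the sources
    from which an edge costs 1 were interleaved with those from which it costs 0, geodesics to the
    two ends of the edge would meet ([interleaved_walks_meet]), and exchanging their tails there
    would contradict their lengths ([farther_not_interleaved]).

    The topology of the disk enters through the vanishing of first cohomology mod 2
    ([locally_trivial_cocycle_trivial]): a bit on the sides that is a coboundary around every vertex
    is the coboundary of a labelling of the triangles. This follows from a Čech argument on the
    convex disk ([cech_trivial]), carried over to M by [glue_local_sections]. It yields an
    orientation of M ([orientable]) and, for a walk between boundary points, a two-colouring of the
    triangles that changes exactly across the walk ([walk_cut]), which does the work of the Jordan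
    curve theorem. *)

(** * Čech cohomology mod 2 of a compact convex set *)

Section ConvexCech.
Variables (R : realType) (V : normedModType R).
Implicit Types (K U : set V) (x y : V).

Definition segment_closed K := forall x y (t : R),
  K x -> K y -> 0 <= t <= 1 -> K (x + t *: (y - x)).

(** Restrict [A] to the segment from [x] to [y]: the parameters where it keeps its initial value
    form a nonempty, relatively open and closed subset of [0,1], hence all of it. *)
Lemma loc_const_segment_closed K (A : V -> bool) : segment_closed K ->
    (forall x, K x -> \forall y \near x, K y -> A y = A x) ->
  forall x y, K x -> K y -> A x = A y.
Proof.
move=> Kseg Aloc x y Kx Ky.
pose p (t : R) : V := x + t *: (y - x).
have p_cts : continuous p.
  move=> t; apply: cvgD; first exact: cvg_cst.
  by apply: cvgZr_tmp; exact: cvg_id.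
pose B : set R := [set t | 0 <= t <= 1 /\ A (p t) = A x].
have Kp (t : R) : 0 <= t <= 1 -> K (p t) by move=> t01; exact: Kseg.
have nearp (t : R) : 0 <= t <= 1 ->
    \forall s \near t, 0 <= s <= 1 -> A (p s) = A (p t).
  move=> t01.
  have ptA : \forall s \near t, K (p s) -> A (p s) = A (p t).
    exact: p_cts (Aloc _ (Kp _ t01)).
  by apply: filterS ptA => s As s01; exact: As (Kp _ s01).
have BE : B = `[0 : R, 1 : R]%classic.
  apply: (@segment_connected R 0 1).
  - exists 0; split; first by rewrite lexx ler01.
    by rewrite /p scale0r addr0.
  - exists (interior [set s | 0 <= s <= 1 -> A (p s) = A x]).
      exact: open_interior.
    apply/seteqP; split => t.
      move=> [t01 tA]; split; first by rewrite /= in_itv.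
      by move: (nearp t t01); rewrite tA.
    move=> [/=]; rewrite in_itv => t01 tI; split=> //.
    by move: (nbhs_singleton tI); exact.
  - exists (~` (interior [set s | 0 <= s <= 1 -> A (p s) <> A x])).
      exact/open_closedC/open_interior.
    apply/seteqP; split => t.
      move=> [t01 tA]; split; first by rewrite /= in_itv.
      by move=> /nbhs_singleton /(_ t01).
    move=> [/=]; rewrite in_itv => t01 tI; split=> //.
    apply: contrapT => tA; apply: tI.
    have := nearp t t01; apply: filterS => s As s01; rewrite As //.
have : B 1 by rewrite BE /= in_itv /= ler01 lexx.
by case=> _; rewrite /p scale1r addrC subrK => ->.
Qed.

Variables (I : Type) (U : I -> set V) (d : I -> I -> V -> bool) (K : set V).
Hypothesis Kseg : segment_closed K.
Hypothesis Kcompact : compact K.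
Hypothesis K0 : K 0.
Hypothesis Uopen : forall i x, K x -> U i x -> \forall y \near x, K y -> U i y.
Hypothesis Ucover : forall x, K x -> exists i, U i x.
Hypothesis dloc : forall i j x, K x -> U i x -> U j x ->
  \forall y \near x, K y -> d i j y = d i j x.
Hypothesis dcocycle : forall i j k x, K x -> U i x -> U j x -> U k x ->
  d i j x (+) d j k x = d i k x.

Lemma cover_lebesgue_number : exists2 e : R, 0 < e &
  forall x, K x -> exists i, forall y, K y -> `|x - y| < e -> U i y.
Proof.
have KN : near_covering K by apply/compact_near_coveringP.
pose P (e : R) (x : V) := exists i, forall y, K y -> `|x - y| < e -> U i y.
have : \forall e \near (0 : R)^'+, K `<=` P e.
  apply: KN => x Kx; have [i Uix] := Ucover Kx.
  have /nbhs_ballP[r /= r0 rU] := Uopen Kx Uix.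
  exists (ball x (r / 2), [set e | e < r / 2]) => /=.
    split; first by apply: nbhsx_ballx; rewrite divr_gt0.
    by apply: nbhs_right_lt; rewrite divr_gt0.
  move=> [x' e] [/= xx' er]; exists i => y Ky x'y; apply: rU => //.
  rewrite -ball_normE /= in xx' *.
  have -> : x - y = (x - x') + (x' - y) by rewrite addrA subrK.
  rewrite (le_lt_trans (ler_normD _ _)) // [r]splitr ltrD //.
  exact: lt_trans er.
move=> /(filterI (nbhs_right_gt 0)) /filter_ex[e [e0 eP]].
by exists e.
Qed.

Lemma cech_trivial : exists eta : I -> V -> bool,
  (forall i x, K x -> U i x -> \forall y \near x, K y -> eta i y = eta i x) /\
  (forall i j x, K x -> U i x -> U j x -> eta i x (+) eta j x = d i j x).
Proof.
have [e e0 eP] := cover_lebesgue_number.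
have [i0 _] := Ucover K0.
(* [c x] is a chart containing the whole [e]-ball around [x]; it may depend on [x] without any
   continuity. *)
have /choice[c cP] : forall x, exists i, K x ->
    forall y, K y -> `|x - y| < e -> U i y.
  move=> x; have [Kx|nKx] := pselect (K x); last by exists i0.
  by have [i Hi] := eP x Kx; exists i.
have cU x : K x -> U (c x) x.
  by move=> Kx; apply: cP => //; rewrite subrr normr0.
have dii i x : K x -> U i x -> d i i x = false.
  by move=> Kx Ux; have := dcocycle Kx Ux Ux Ux; case: (d i i x).
have dC i j x : K x -> U i x -> U j x -> d i j x = d j i x.
  move=> Kx Ux Ujx; have := dcocycle Kx Ux Ujx Ux.
  by rewrite dii //; case: (d i j x); case: (d j i x).
(* The part of [K] within [e / 2] of [x] is convex and lies in both charts, so the locally constant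
   transition is constant there. *)
have dconst i j x y : K x -> K y -> `|x - y| < e / 2 ->
   (forall z, K z -> `|x - z| < e / 2 -> U i z) ->
   (forall z, K z -> `|x - z| < e / 2 -> U j z) -> d i j x = d i j y.
  move=> Kx Ky xy iU jU.
  pose L := K `&` [set z | `|x - z| < e / 2].
  have Lseg : segment_closed L.
    move=> u v t [Ku xu] [Kv xv] t01; split; first exact: Kseg.
    have /andP[t0 t1] := t01.
    rewrite /= in xu xv *.
    have -> : x - (u + t *: (v - u)) = (1 - t) *: (x - u) + t *: (x - v).
      rewrite scalerBl scale1r -addrA [- _ + _]addrC -scalerBr opprB.
      by rewrite [x - v + _]addrC subrKA opprD addrA -scalerN opprB.
    rewrite (le_lt_trans (ler_normD _ _)) // !normrZ ger0_norm ?subr_ge0//.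
    rewrite (ger0_norm t0).
    have m1 : (1 - t) * `|x - u| + t * `|x - v| <=
       (1 - t) * Num.max `|x - u| `|x - v| + t * Num.max `|x - u| `|x - v|.
      by rewrite lerD // ler_wpM2l ?subr_ge0 // le_max lexx ?orbT.
    apply: (le_lt_trans m1).
    by rewrite -mulrDl subrK mul1r gt_max xu xv.
  apply: (loc_const_segment_closed (K := L)) => //.
  - move=> z [Kz xz]; have := dloc Kz (iU _ Kz xz) (jU _ Kz xz).
    by apply: filterS => w + [Kw _]; exact.
  - by split; rewrite //= subrr normr0 divr_gt0.
                                                                            
                                                                       
                                                         
(* Transition between the charts chosen at two nearby points. *)
pose S x y := d (c x) (c y) x.
have near2 x y : K x -> K y -> `|x - y| < e / 2 ->
    forall z, K z -> `|x - z| < e / 2 -> U (c y) z.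
  move=> Kx Ky xy z Kz xz; apply: cP => //.
  have -> : y - z = (x - z) - (x - y) by rewrite opprB [RHS]addrC subrKA.
  by rewrite (le_lt_trans (ler_normB _ _)) // [e]splitr ltrD.
(* Transport around a small square is trivial: all four charts contain the [e / 2]-ball of [x], so
   every transition may be evaluated at [x], where the cocycle identity applies. *)
have squareS x y x' y' : K x -> K y -> K x' -> K y' ->
   `|x - y| < e / 4 -> `|x - x'| < e / 4 -> `|x' - y'| < e / 4 ->
   S x y (+) (S x x' (+) S y y') = S x' y'.
  move=> Kx Ky Kx' Ky' xy xx' xy'.
  have e42 : e / 4 < e / 2 by rewrite ltr_pM2l // ltf_pV2 ?posrE// ltr_nat.
  have xy2 : `|x - y| < e / 2 by apply: lt_trans e42.
  have xx'2 : `|x - x'| < e / 2 by apply: lt_trans e42.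
  have xy'2 : `|x - y'| < e / 2.
    have -> : x - y' = (x - x') + (x' - y') by rewrite addrA subrK.
    rewrite (le_lt_trans (ler_normD _ _)) //.
    have -> : e / 2 = e / 4 + e / 4 by field.
    by rewrite ltrD.
  have xx2 : `|x - x| < e / 2 by rewrite subrr normr0 divr_gt0.
  rewrite /S.
  rewrite -(@dconst (c y) (c y') x y) //; try exact: near2.
  rewrite -(@dconst (c x') (c y') x x') //; try exact: near2.
  have Ux : U (c x) x by apply: cU.
  have Uy : U (c y) x by apply: (near2 x).
  have Ux' : U (c x') x by apply: (near2 x).
  have Uy' : U (c y') x by apply: (near2 x).
  rewrite addbCA dcocycle // (dC (c x) (c x')) //.
  by rewrite dcocycle.
(* One number of steps serves all rays because [K] is bounded. *)
have [M KM] : exists M : nat, forall x, K x -> `|x| / M.+1%:R < e / 4.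
  have [b b0 Kb] := ex_strict_bound_gt0 (compact_bounded Kcompact).
  exists (Num.truncn (b / (e / 4))) => x Kx.
  rewrite ltr_pdivrMr // mulrC -ltr_pdivrMr ?divr_gt0 //.
  apply: (@le_lt_trans _ _ (b / (e / 4))).
    by rewrite ler_pM2r ?invr_gt0 ?divr_gt0 //; apply/ltW; exact: Kb.
  by rewrite truncnS_gt.
pose N := M.+1.
pose pt k x : V := (k%:R / N%:R) *: x.
have ptK k x : (k <= N)%N -> K x -> K (pt k x).
  move=> kN Kx; have := @Kseg 0 x (k%:R / N%:R) K0 Kx.
  rewrite add0r subr0; apply.
  by rewrite divr_ge0 //= ler_pdivrMr // mul1r ler_nat.
have ptN x : pt N x = x by rewrite /pt divff ?pnatr_eq0 // scale1r.
have pt0 x : pt 0%N x = 0 by rewrite /pt mul0r scale0r.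
have ptS k x : K x -> `|pt k x - pt k.+1 x| < e / 4.
  move=> Kx; rewrite /pt -scalerBl -mulrBl -addn1 natrD opprD addrA subrr.
  rewrite add0r mulN1r normrZ normrN ger0_norm ?invr_ge0 // mulrC.
  exact: KM.
pose h x := \big[addb/false]_(k < N) S (pt k x) (pt k.+1 x).
have hS x y : K x -> K y -> `|x - y| < e / 4 -> h x (+) h y = S x y.
  move=> Kx Ky xy.
  (* Compare transport along two neighbouring rays square by square; both start at 0, where the
     discrepancy vanishes. *)
  have : forall m, (m <= N)%N ->
      (\big[addb/false]_(k < m) S (pt k x) (pt k.+1 x)) (+)
      (\big[addb/false]_(k < m) S (pt k y) (pt k.+1 y)) = S (pt m x) (pt m y).
    elim=> [|m IH] mN; first by rewrite !big_ord0 !pt0 /S dii //; exact: cU.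
    rewrite !big_ord_recr /= addbACA IH ?(ltnW mN) //.
    have xym k : (k <= N)%N -> `|pt k x - pt k y| < e / 4.
      move=> kN; rewrite /pt -scalerBr normrZ ger0_norm ?divr_ge0 //.
      apply: le_lt_trans xy; rewrite ler_piMl //.
      by rewrite ler_pdivrMr // mul1r ler_nat.
    by apply: squareS; rewrite ?ptS ?xym ?(ltnW mN) //; apply: ptK;
      rewrite ?(ltnW mN).
  by move=> /(_ N (leqnn N)); rewrite !ptN.
have hnear x y : K x -> K y -> `|x - y| < e / 4 ->
    h y = h x (+) d (c x) (c y) y.
  move=> Kx Ky xy.
  have yx : `|y - x| < e / 4 by rewrite distrC.
  have e42 : e / 4 < e / 2 by rewrite ltr_pM2l // ltf_pV2 ?posrE// ltr_nat.
  have cx : U (c x) y.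
    apply: cP => //; apply: lt_trans xy _.
    by rewrite ltr_pdivrMr // ltr_pMr // ltr1n.
  rewrite (dC (c x)) //; last exact: cU.
  by rewrite -[d _ _ y]/(S y x) -hS // [h y (+) _]addbC addKb.
exists (fun i x => h x (+) d i (c x) x); split=> [i x Kx Ux|i j x Kx Ux Ujx].
  have Uin := Uopen Kx Ux.
  have dn := dloc Kx Ux (cU _ Kx).
  have bn : \forall y \near x, `|x - y| < e / 4.
    by apply/nbhs_ballP; exists (e / 4); rewrite /= ?divr_gt0 // -ball_normE.
  apply: filterS3 Uin dn bn => y Uiy dy xy Ky.
  have cx : U (c x) y.
    apply: cP => //; apply: lt_trans xy _.
    by rewrite ltr_pdivrMr // ltr_pMr // ltr1n.
  rewrite (hnear x y) // -(dy Ky) -addbA; congr addb.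
  have cy := cU _ Ky.
  rewrite (dC i (c y)) //; last exact: Uiy.
  rewrite dcocycle //; last exact: Uiy.
  by apply: dC => //; exact: Uiy.
rewrite addbACA addbb addFb (dC j) //; last exact: cU.
by rewrite dcocycle //; exact: cU.
Qed.

End ConvexCech.

                                                                     

(** * Gluing local sections over a surface whose realization is a disk *)

Section Disk.
Variable R : realType.

Definition disk : set (R * R) := [set p | p.1 ^+ 2 + p.2 ^+ 2 <= 1].

Lemma disk_segment_closed : segment_closed disk.
Proof.
move=> x y t; move: x y => [x1 x2] [y1 y2]; rewrite /disk /= => x_1 y_1 /andP[t0 t1].
have sq0 (u v : R) : 0 <= t * (1 - t) * (u - v) ^+ 2.
  by rewrite mulr_ge0 ?sqr_ge0 ?mulr_ge0 ?subr_ge0.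
have cvx (u v : R) : (u + t * (v - u)) ^+ 2 <= (1 - t) * u ^+ 2 + t * v ^+ 2.
  rewrite -subr_ge0.
  have -> : (1 - t) * u ^+ 2 + t * v ^+ 2 - (u + t * (v - u)) ^+ 2 =
    t * (1 - t) * (u - v) ^+ 2 by ring.
  exact: sq0.
apply: (le_trans (lerD (cvx _ _) (cvx _ _))).
rewrite addrACA -!mulrDr.
have {2}-> : 1 = (1 - t) * 1 + t * 1 :> R by ring.
by apply: lerD; rewrite ler_wpM2l // subr_ge0.
Qed.

Lemma disk0 : disk 0.
Proof. by rewrite /disk /= expr0n /= addr0 ler01. Qed.

Lemma disk_compact : compact disk.
Proof.
have sq : compact (`[-1 : R, 1 : R]%classic `*` `[-1 : R, 1 : R]%classic).
  by apply: compact_setX; exact: segment_compact.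
apply: (subclosed_compact _ sq).
  have -> : disk = (fun p : R * R => p.1 ^+ 2 + p.2 ^+ 2) @^-1` [set x | x <= 1] by [].
  apply: preimage_closed; last exact: closed_le.
  move=> p _; apply: cvgD.
    by apply: (@continuous_comp _ _ _ fst (fun x : R => x ^+ 2));
      [exact: cvg_fst | exact: exprn_continuous].
  by apply: (@continuous_comp _ _ _ snd (fun x : R => x ^+ 2));
    [exact: cvg_snd | exact: exprn_continuous].
move=> [x y]; rewrite /disk /= => xy; rewrite !in_itv /= -!ler_norml.
by split; rewrite -(@ler_pXn2r _ 2) ?nnegrE ?ler01 // expr1n real_normK ?num_real //; nra.
Qed.

End Disk.

Section Monodromy.
Variables (R : realType) (M : fine_surface).
Hypothesis diskM : homeomorphic (realization R M) (closed_disk R).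
Local Notation E := (triangles R M).

Definition glued_at (s : side M) (p q : E) : Prop :=
  [/\ tag p = s.1, coord p s.2 = 0, tag q = (glue s).1,
      coord q (glue s).2 = 0
    & forall k : 'I_2, coord p (lift s.2 k) = coord q (lift (glue s).2 k)].

Lemma glued_at_sym s p q : glued_at s p q -> glued_at (glue s) q p.
Proof. by case=> ? ? ? ? pq; split; rewrite ?glueK // => k; rewrite pq. Qed.

Definition saturated (A : set E) := forall s p q, glued_at s p q -> A p -> A q.

Lemma saturated_eqv (A : set E) p q :
  saturated A -> point_eqv p q -> A p -> A q.
Proof.
move=> Asat /asboolP pq.
suff: A p <-> A q by case.
elim: pq => {p q} [p q [s pq]|p|p q _ IH|p q r _ IH1 _ IH2].
- by split; [exact: Asat pq|exact: Asat (glued_at_sym pq)].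
- by [].
- by rewrite IH.
- by rewrite IH1.
Qed.

(** [Q] is the projection of the disjoint triangles to the realization, followed by the
    homeomorphism. The last clause states pointwise that [Q] is a quotient map onto the disk: an
    open saturated set contains all fibres near any fibre it meets. Through it local constancy
    descends to the disk. *)
Lemma disk_parametrization : exists Q : E -> R * R,
  [/\ continuous Q, forall e, disk (Q e), forall x, disk x -> exists e, Q e = x,
    forall e e', Q e = Q e' <-> point_eqv e e'
  & forall A, saturated A -> open A -> forall e, A e ->
      \forall y \near Q e, forall e', Q e' = y -> A e'].
Proof.
have [f [g [f_cts g_cts fK gK]]] := diskM.
pose pi (e : E) : realization R M := \pi_{eq_quot (@point_eqv R M)} e.
have pi_cts : continuous pi by exact: pi_continuous.
have Qinj e e' : \val (f (pi e)) = \val (f (pi e')) -> point_eqv e e'.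
  by move=> /val_inj /(can_inj fK) /eqmodP.
exists (fun e => \val (f (pi e))); split=> //.
- move=> e; apply: (@continuous_comp _ _ _ (f \o pi) (fun x => \val x)).
    by apply: continuous_comp; [exact: pi_cts|exact: f_cts].
  exact: initial_continuous.
- by move=> e; apply: set_valP.
- move=> x Kx; exists (repr (g (SigSub (mem_set Kx)))).
  by rewrite /pi reprK gK.
- move=> e e'; split=> [|ee']; first exact: Qinj.
  by rewrite /pi; congr (\val (f _)); apply/eqmodP.
move=> A Asat oA e Ae.
pose B : set (realization R M) := [set x | A (repr x)].
have oB : open B.
  rewrite /open /= /quotient_open.
  suff -> : \pi_(quotient_topology {eq_quot @point_eqv R M}) @^-1` B = A by [].
  have pir e' : point_eqv (repr (pi e')) e' by apply/eqmodP; rewrite reprK.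
  apply/seteqP; split => e'; first exact: (saturated_eqv Asat (pir e')).
  by apply: (saturated_eqv Asat); rewrite point_eqv_sym; exact: pir.
have : open (g @^-1` B) by apply: open_comp => // x _; exact: g_cts.
move=> [W oW WE].
have We : W (\val (f (pi e))).
  suff : (g @^-1` B) (f (pi e)) by rewrite -WE.
  rewrite /= fK /B /=; apply: (saturated_eqv Asat) Ae.
  by apply/eqmodP; rewrite reprK.
apply: (filterS _ (open_nbhs_nbhs (conj oW We))) => y Wy e' e'y.
have We' : W (\val (f (pi e'))) by rewrite e'y.
have : (g @^-1` B) (f (pi e')) by rewrite -WE.
rewrite /= fK /B /=; apply: (saturated_eqv Asat).
by apply/eqmodP; rewrite reprK.
Qed.

Variables (I : Type) (Ut : I -> set E) (sigma : I -> E -> bool).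
Variable w : side M -> bool.
Hypothesis Ut_sat : forall i, saturated (Ut i).
Hypothesis Ut_cover : forall e, exists i, Ut i e.
Hypothesis sigma_open : forall i b, open (Ut i `&` [set e | sigma i e = b]).
Hypothesis sigma_glue : forall i s p q, glued_at s p q -> Ut i p ->
  sigma i p (+) sigma i q = w s.

(** Two local sections jump by the same [w s] across a gluing, so their difference descends to a
    locally constant cocycle on the disk. [cech_trivial] gives corrections [eta] that make the
    sections agree on overlaps. *)
Lemma glue_local_sections : exists tau : E -> bool,
  (forall e, \forall e' \near e, tau e' = tau e) /\
  (forall s p q, glued_at s p q -> tau p (+) tau q = w s).
Proof.
have [Q [Q_cts QK Qsurj Q_eqv Qnear]] := disk_parametrization.
have UtE i : Ut i = \bigcup_b (Ut i `&` [set e | sigma i e = b]).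
  by apply/seteqP; split=> e => [Ue|[b _ []//]]; exists (sigma i e).
have Ut_open i : open (Ut i).
  by rewrite UtE; apply: bigcup_open => b _; exact: sigma_open.
have [e0 _] := Qsurj 0 (disk0 R).
(* A choice of preimages, not continuous; saturation makes what is read through [k] independent of
   the choice. *)
have /choice[k kP] : forall x, exists e, disk x -> Q e = x.
  move=> x; have [/Qsurj[e <-]|nx] := pselect (disk x); first by exists e.
  by exists e0.
have kQ e : Q (k (Q e)) = Q e by apply: kP.
pose U i : set (R * R) := [set x | Ut i (k x)].
pose d i j x := sigma i (k x) (+) sigma j (k x).
have UQ i e : U i (Q e) <-> Ut i e.
  split; apply: saturated_eqv => //; first exact/Q_eqv.
  by rewrite point_eqv_sym; exact/Q_eqv.
pose A i j b := Ut i `&` Ut j `&` [set e | sigma i e (+) sigma j e = b].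
have A_open i j b : open (A i j b).
  have -> : A i j b = \bigcup_c ((Ut i `&` [set e | sigma i e = c]) `&`
                            (Ut j `&` [set e | sigma j e = c (+) b])).
    apply/seteqP; split=> e.
      move=> [[iU jU] /= bE]; exists (sigma i e) => //; split=> //; split=> //.
      by rewrite -bE addKb.
    by move=> [c _ [[iU /= ic] [jU /= jc]]]; split=> //=; rewrite ic jc addKb.
  by apply: bigcup_open => c _; apply: openI; exact: sigma_open.
have A_sat i j b : saturated (A i j b).
  move=> s p q pq [[iU jU] /= bE]; split.
    by split; apply: Ut_sat pq _.
  rewrite /= -bE.
  have := sigma_glue pq iU; have := sigma_glue pq jU.
  by case: (w s); case: (sigma i p); case: (sigma i q); case: (sigma j p);
    case: (sigma j q).
have dQ i j e : Ut i e -> Ut j e -> d i j (Q e) = sigma i e (+) sigma j e.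
  move=> iU jU.
  have : A i j (sigma i e (+) sigma j e) (k (Q e)).
    apply: (@saturated_eqv _ e); [exact: A_sat| |by []].
    by rewrite point_eqv_sym; apply/Q_eqv; rewrite kQ.
  by case.
have [|||||||eta [etaloc eta_d]] := @cech_trivial R (R * R)%type I U d (@disk R).
- exact: disk_segment_closed.
- exact: disk_compact.
- exact: disk0.
- move=> i x Kx Ux.
  have := Qnear _ (@Ut_sat i) (Ut_open i) _ Ux; rewrite kP //.
  apply: filterS => y yP Ky; apply: yP; exact: kP.
- by move=> x Kx; exact: Ut_cover.
- move=> i j x Kx iU jU.
  have Akx : A i j (d i j x) (k x) by [].
  have := Qnear _ (@A_sat i j (d i j x)) (A_open _ _ _) _ Akx; rewrite kP //.
  by apply: filterS => y yP Ky; have [_] := yP (k y) (kP _ Ky).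
- by move=> i j l x _ _ _ _; rewrite /d -addbA addKb.
have /choice[c cP] : forall e, exists i, Ut i e by exact: Ut_cover.
pose tau e := sigma (c e) e (+) eta (c e) (Q e).
have tauE i e : Ut i e -> tau e = sigma i e (+) eta i (Q e).
  move=> iU; have := eta_d (c e) i (Q e) (QK e) ((UQ _ _).2 (cP e)) ((UQ _ _).2 iU).
  rewrite dQ // /tau.
  by case: (sigma _ e); case: (sigma _ e); case: (eta _ _); case: (eta _ _).
exists tau; split=> [e|s p q pq].
  have Uc := cP e; set i := c e in Uc.
  have nU : \forall e' \near e, Ut i e' /\ sigma i e' = sigma i e.
    apply: (@open_nbhs_nbhs _ e (Ut i `&` [set e' | sigma i e' = sigma i e])).
    by split; first exact: sigma_open.
  have neta : \forall e' \near e, eta i (Q e') = eta i (Q e).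
    have : \forall e' \near e, disk (Q e') -> eta i (Q e') = eta i (Q e).
      exact: Q_cts (etaloc i (Q e) (QK e) ((UQ _ _).2 Uc)).
    by apply: filterS => e'; exact.
  apply: filterS2 nU neta => e' [Ue' se'] ee'.
  by rewrite (tauE i) // (tauE i e) // se' ee'.
have Uq := Ut_sat pq (cP p).
rewrite (tauE _ _ (cP p)) (tauE _ _ Uq).
rewrite ((Q_eqv p q).2); last by apply/asboolP; apply: rst_step; exists s.
by rewrite addbACA addbb addbF (sigma_glue pq (cP p)).
Qed.

End Monodromy.

(** * Vanishing of mod 2 cohomology in terms of sides and corners *)

Section Simplex.
Variable R : realType.

Lemma simplex_segment_closed : segment_closed (@simplex R).
Proof.
move=> x y t [x0 x1] [y0 y1] /andP[t0 t1]; split=> [i|].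
  rewrite !mxE.
  have -> : x ord0 i + t * (y ord0 i - x ord0 i) =
    (1 - t) * x ord0 i + t * y ord0 i by ring.
  by rewrite addr_ge0 // mulr_ge0 // subr_ge0.
have -> : \sum_i (x + t *: (y - x)) ord0 i =
   \sum_i x ord0 i + t * (\sum_i y ord0 i - \sum_i x ord0 i).
  rewrite -sumrB mulr_sumr -big_split /=.
  by apply: eq_bigr => i _; rewrite !mxE.
by rewrite x1 y1 subrr mulr0 addr0.
Qed.

Lemma side_midpoint_simplex (i : 'I_3) :
  simplex (\row_j (if j == i then 0 else 1 / 2) : 'rV[R]_3).
Proof.
split=> [j|]; first by rewrite mxE; case: eqP => // _; lra.
rewrite !big_ord_recr big_ord0 /= !mxE.
by case: i => [[|[|[|//]]] p]; rewrite /eq_op /=; lra.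
Qed.

Lemma coord_gt_open (i j : 'I_3) : open [set x : 'rV[R]_3 | x ord0 i < x ord0 j].
Proof.
have -> : [set x : 'rV[R]_3 | x ord0 i < x ord0 j] =
   (fun x : 'rV[R]_3 => x ord0 j - x ord0 i) @^-1` [set r | 0 < r].
  by apply/seteqP; split=> x /=; rewrite subr_gt0.
apply: open_comp; last exact: open_gt.
move=> x _.
apply: (@continuousB _ _ _ (fun y : 'rV[R]_3 => y ord0 j)
                           (fun y : 'rV[R]_3 => y ord0 i));
  exact: coord_continuous.
Qed.

Lemma coord_gt_cst_open (i : 'I_3) (c : R) : open [set x : 'rV[R]_3 | c < x ord0 i].
Proof.
have -> : [set x : 'rV[R]_3 | c < x ord0 i] =
   (fun x : 'rV[R]_3 => x ord0 i) @^-1` [set r | c < r] by [].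
apply: open_comp; last exact: open_gt.
by move=> x _; exact: coord_continuous.
Qed.

End Simplex.

Section Triviality.
Variables (R : realType) (M : fine_surface).
Hypothesis diskM : homeomorphic (realization R M) (closed_disk R).
Local Notation E := (triangles R M).

Definition coords (p : E) : 'rV[R]_3 := \val (tagged p).

Lemma coords_simplex p : simplex (coords p).
Proof. exact: set_valP. Qed.

Section Charts.
Variables (I : Type) (O : I -> 'I_3 -> set 'rV[R]_3) (v : I -> corner M -> bool).
Hypothesis O_open : forall i j, open (O i j).
Hypothesis O_disjoint : forall i j j' x, O i j x -> O i j' x -> j = j'.

Definition chart i : set E := [set e : E | exists j, O i j (coords e)].
(** On the region [O i j] of triangle [t] the section has the constant value [v i (t, j)]; the
    regions with the same [i] are disjoint, so at most one [j] is involved. *)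
Definition chart_section i (e : E) : bool :=
  `[< exists2 j, O i j (coords e) & v i (tag e, j) >].

Lemma chart_sectionE i j e : O i j (coords e) ->
  chart_section i e = v i (tag e, j).
Proof.
move=> Oj; apply/asboolP/idP => [[j' Oj' vj']|vj]; last by exists j.
by rewrite (O_disjoint Oj Oj').
Qed.

Lemma chart_section_open i b : open (chart i `&` [set e | chart_section i e = b]).
Proof.
have -> : chart i `&` [set e | chart_section i e = b] =
    \bigcup_j [set e : E | O i j (coords e) /\ v i (tag e, j) = b].
  apply/seteqP; split=> e.
    by move=> [[j Oj]] /=; rewrite (chart_sectionE Oj) => vb; exists j.
  by move=> [j _ [Oj vb]]; split; [exists j|rewrite /= (chart_sectionE Oj)].
apply: bigcup_open => j _; apply/sigT_openP => t.
have [vb|vb] := pselect (v i (t, j) = b).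
  have -> : existT _ t @^-1` [set e : E | O i j (coords e) /\
      v i (tag e, j) = b] = (fun z : set_type (@simplex R) => \val z) @^-1` O i j.
    by apply/seteqP; split=> z /=; [case|].
  by apply: open_comp => // z _; exact: initial_continuous.
rewrite (_ : _ @^-1` _ = set0); first exact: open0.
by apply/seteqP; split=> z //= [].
Qed.

End Charts.

                                                                            
                                                                             
                                                                               
                                                                                
                                                                       
Inductive stratum := Vertices | Edges | Faces.

(** The index [j] is a corner for [Vertices], the side opposite to vertex [j] for [Edges], and a
    dummy fixed to 0 for [Faces]. The bound 1/2 keeps the region of a corner off the opposite side;
    maximality of the coordinate makes the regions disjoint even outside the simplex. *)
Definition stratum_nbhs (i : stratum) (j : 'I_3) : set 'rV[R]_3 :=
  match i with
  | Vertices => [set x | 1 / 2 < x ord0 j /\ forall j', j' != j -> x ord0 j' < x ord0 j]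
  | Edges => [set x | forall j', j' != j -> x ord0 j < x ord0 j']
  | Faces => [set x | j = ord0 /\ forall j', 0 < x ord0 j']
  end.

Lemma open_ord3 (P : 'I_3 -> set 'rV[R]_3) (Q : pred 'I_3) :
  (forall j, open (P j)) -> open [set x | forall j, Q j -> P j x].
Proof.
move=> Po; pose S j := [set x | Q j -> P j x].
have So j : open (S j).
  have [Qj|Qj] := boolP (Q j).
    by have -> : S j = P j by apply/seteqP; split=> x; [move=> Sx; exact: (Sx Qj)|move=> Px; rewrite /S].
  have -> : S j = setT by apply/seteqP; split=> x //= _; rewrite /S /= (negPf Qj).
  exact: openT.
have -> : [set x | forall j, Q j -> P j x] =
    S ord0 `&` S (lift ord0 ord0) `&` S ord_max.
  apply/seteqP; split=> x; first by move=> xP; do 2?split; exact: xP.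
  move=> [[x0 x1] x2] j; case: (unliftP ord0 j) => [j'|] -> //.
  have [->//|j'1] : j' = ord0 \/ j' = ord_max.
    by case: j' => [[|[|//]]] p; [left|right]; apply: val_inj.
  by have -> : lift ord0 j' = ord_max by rewrite j'1; apply: val_inj.
by do 2?apply: openI.
Qed.

Lemma stratum_nbhs_open i j : open (stratum_nbhs i j).
Proof.
case: i.
- apply: openI; first exact: coord_gt_cst_open.
  by apply: (@open_ord3 (fun j' => [set x : 'rV[R]_3 | x ord0 j' < x ord0 j])
    (fun j' => j' != j)) => j'; exact: coord_gt_open.
- by apply: (@open_ord3 (fun j' => [set x : 'rV[R]_3 | x ord0 j < x ord0 j'])
    (fun j' => j' != j)) => j'; exact: coord_gt_open.
have [->|j0] := eqVneq j ord0; last first.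
  have -> : stratum_nbhs Faces j = set0; last exact: open0.
  by apply/seteqP; split=> x //= [/eqP]; rewrite (negPf j0).
have -> : stratum_nbhs Faces ord0 = [set x | forall j, xpredT j -> 0 < x ord0 j].
  apply/seteqP; split=> x /=; first by case=> _ x0 j' _; exact: x0.
  by move=> x0; split=> // j'; exact: x0.
apply: (@open_ord3 (fun j => [set x : 'rV[R]_3 | 0 < x ord0 j])) => j'.
exact: coord_gt_cst_open.
Qed.

Lemma stratum_nbhs_disjoint i j j' x :
  stratum_nbhs i j x -> stratum_nbhs i j' x -> j = j'.
Proof.
case: i => /=; last by case=> -> _ [-> _].
- move=> [_ xj] [_ xj']; apply/eqP/contraT => jj'.
  by have := lt_trans (xj' j jj') (xj j' _); rewrite ltxx eq_sym; exact.
- move=> xj xj'; apply/eqP/contraT => jj'.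
  by have := lt_trans (xj' j jj') (xj j' _); rewrite ltxx eq_sym; exact.
Qed.

Lemma stratum_cover (e : E) : exists i, chart stratum_nbhs i e.
Proof.
have [x0 x1] := coords_simplex e.
set x := coords e in x0 x1 *.
have [xpos|] := pselect (forall j, 0 < x ord0 j); first by exists Faces, ord0.
move=> /existsNP[j /negP]; rewrite -leNgt => xj.
have {}xj : x ord0 j = 0 by apply/eqP; rewrite eq_le xj x0.
have [xj'|] := pselect (forall j', j' != j -> x ord0 j < x ord0 j').
  by exists Edges, j.
move=> /existsNP[j' /not_implyP[j'j /negP]]; rewrite -leNgt xj => xj'.
have {}xj' : x ord0 j' = 0 by apply/eqP; rewrite eq_le xj' x0.
exists Vertices.
have [l lj lj'] : exists2 l, l != j & l != j'.
  move: j j' j'j {xj xj'} => -[[|[|[|//]]] p] [[|[|[|//]]] q] //= _;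
  solve [by exists (Ordinal (isT : (0 < 3)%N)) | by exists (Ordinal (isT : (1 < 3)%N))
  | by exists (Ordinal (isT : (2 < 3)%N))].
have oth k : k != l -> x ord0 k = 0.
  move=> kl; have [->//|kj] := eqVneq k j; have [->//|kj'] := eqVneq k j'.
  exfalso; move: j j' k l j'j lj lj' kl kj kj' {xj xj'}.
  by move=> [[|[|[|//]]] ?] [[|[|[|//]]] ?] [[|[|[|//]]] ?] [[|[|[|//]]] ?].
have xl : x ord0 l = 1.
  by rewrite -x1 (bigD1 l) //= big1 ?addr0 // => k; exact: oth.
exists l; split; first by rewrite -/x xl; lra.
by move=> k kl; rewrite -/x oth // xl.
Qed.

(** [H] is a section of the double cover defined by [w] near the vertices. Near open edges and
    inside faces sections are immediate, so [glue_local_sections] yields a global one, and it is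
    constant on each triangle. *)
Theorem locally_trivial_cocycle_trivial (w : side M -> bool) (H : corner M -> bool) :
  (forall s k, H (side_end s k) (+) H (side_end (glue s) k) = w s) ->
  exists h : triangle M -> bool, forall s : side M, h s.1 (+) h (glue s).1 = w s.
Proof.
move=> Hw.
have w_sym s : w (glue s) = w s by rewrite -(Hw s ord0) -(Hw _ ord0) glueK addbC.
have w_fix s : glue s = s -> w s = false by move=> gs; rewrite -(Hw s ord0) gs addbb.
(* Near an edge, put the whole jump on one of its two glued sides, selected by an arbitrary
   ranking. *)
pose HE (s : side M) := w s && (enum_rank s < enum_rank (glue s))%N.
have HEw s : HE s (+) HE (glue s) = w s.
  rewrite /HE glueK w_sym; have [gs|gs] := eqVneq (glue s) s; first by rewrite w_fix.
  case: (w s) => //=; case: (ltngtP (enum_rank s)) => // /ord_inj /enum_rank_inj gs'.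
  by rewrite -gs' eqxx in gs.
pose v i := match i with Vertices => H | Edges => HE | Faces => fun=> false end.
(* A gluing maps each region into a region of the same stratum, and the section values differ by
   [w s]. *)
have glued i s (p q : E) j : glued_at s p q -> stratum_nbhs i j (coords p) ->
    exists2 j', stratum_nbhs i j' (coords q) &
      v i (tag p, j) (+) v i (tag q, j') = w s.
  move=> [ps p0 qs q0 pq]; have [pge _] := coords_simplex p.
  case: i => /=.
  - move=> [pj pj']; have : j != s.2.
      by apply/eqP => js; move: pj; rewrite js -/(coord p s.2) p0; lra.
    rewrite eq_sym => /unlift_some[k jk _].
    exists (lift (glue s).2 k); last by rewrite -(Hw s k) /side_end ps qs jk.
    split; first by rewrite -/(coord q _) -pq -jk.
    move=> j'; rewrite -!/(coord _ _) -pq -jk.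
    case: (unliftP (glue s).2 j') => [k' ->|->] jj'.
      rewrite -pq; apply: pj'; rewrite jk.
      by apply: contra_neq jj' => /lift_inj->.
    by rewrite q0; apply: le_lt_trans (pge s.2) (pj' _ _); rewrite jk neq_lift.
  - move=> pj; have js : j = s.2.
      apply/eqP/contraT; rewrite eq_sym => /pj.
      by rewrite -/(coord p s.2) p0 ltNge pge.
    exists (glue s).2; last by rewrite js ps qs -!surjective_pairing HEw.
    move=> j'; rewrite eq_sym => /unlift_some[k -> _].
    rewrite -!/(coord _ _) q0 -pq -p0 -js; apply: pj.
    by rewrite js eq_sym neq_lift.
  - by move=> [_ /(_ s.2)]; rewrite -/(coord p s.2) p0 ltxx.
have [||||tau [tau_loc tau_w]] :=
  @glue_local_sections R M diskM stratum (chart stratum_nbhs)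
    (chart_section stratum_nbhs v) w.
- by move=> i s p q pq [j pj]; have [j' qj' _] := glued i s p q j pq pj; exists j'.
- exact: stratum_cover.
- by move=> i b; apply: chart_section_open;
    [exact: stratum_nbhs_open|exact: stratum_nbhs_disjoint].
- move=> i s p q pq [j pj]; have [j' qj' <-] := glued i s p q j pq pj.
  by rewrite (chart_sectionE v stratum_nbhs_disjoint pj)
             (chart_sectionE v stratum_nbhs_disjoint qj').
pose pt (t : triangle M) (z : set_type (@simplex R)) : E := existT _ t z.
(* The simplex is convex, so the locally constant [tau] is constant on a triangle; the value [false]
   outside the simplex is only filler. *)
have tau_cst t z z' : tau (pt t z) = tau (pt t z').
  pose A x := if pselect (simplex x) is left xs then tau (pt t (SigSub (mem_set xs))) else false.
  have AE u : A (\val u) = tau (pt t u).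
    rewrite /A; case: pselect => [us|[]]; last exact: set_valP.
    by congr (tau (pt t _)); apply: val_inj.
  rewrite -!AE; apply: (@loc_const_segment_closed R 'rV[R]_3 (@simplex R) A
     (@simplex_segment_closed R));
    [|exact: set_valP|exact: set_valP].
  move=> x xs.
  pose u : set_type (@simplex R) := SigSub (mem_set xs).
  have ux : \val u = x by [].
  have : nbhs u [set z | tau (pt t z) = tau (pt t u)].
    by have := @existT_continuous _ (fun=> set_type (@simplex R) : topologicalType) t u _ (tau_loc (pt t u)).
  rewrite nbhsE /= => -[B [[W oW WE] Bu] Btau].
  have Wx : W x by move: Bu; rewrite -WE.
  apply: filterS (open_nbhs_nbhs (conj oW Wx)) => y Wy ys.
  have -> : y = \val (SigSub (mem_set ys) : set_type (@simplex R)) by [].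
  by rewrite -ux !AE; apply: Btau; rewrite -WE.
pose mid (s : side M) : E := pt s.1 (SigSub (mem_set (@side_midpoint_simplex R s.2))).
exists (fun t => tau (mid (t, ord0))) => s.
rewrite (tau_cst s.1 _ (tagged (mid s))) (tau_cst (glue s).1 _ (tagged (mid (glue s)))).
apply: tau_w; split=> //=; rewrite /coord /= ?mxE ?eqxx // => k.
by rewrite !mxE ![lift _ _ == _]eq_sym !(negPf (neq_lift _ _)).
Qed.

End Triviality.

                                                 

(** * Linear algebra over the field with two elements, and sums over involutions *)

Lemma F2_natr_neq0 (x : 'F_2) : (x != 0)%:R = x.
Proof. by case: x => [[|[|//]]] p; apply: val_inj. Qed.

Lemma F2_addrr (x : 'F_2) : x + x = 0.
Proof. by case: x => [[|[|//]]] p; apply: val_inj. Qed.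

Lemma F2_addr_eq0 (x y : 'F_2) : x + y = 0 -> x = y.
Proof. by move=> xy; rewrite -[x]addr0 -(F2_addrr y) addrA xy add0r. Qed.

Lemma F2_natr_addb (b c : bool) : (b (+) c)%:R = b%:R + c%:R :> 'F_2.
Proof. by case: b; case: c; apply: val_inj. Qed.

                                                                               
                                                        
(** Duality over F_2. The task is to write [u] as an [a]-invariant function plus a [g]-invariant
    one, and the obstructions are the functionals killing both chosen spaces. Such a functional is
    the indicator of an invariant set [K] that avoids the fixed points of [g]. *)
Lemma two_involutions_potential (F : finType) (a g : F -> F) (u : F -> bool) :
    involutive a -> involutive g ->
    (forall K : pred F, (forall x, K (a x) = K x) -> (forall x, K (g x) = K x) ->
       (forall x, g x = x -> ~~ K x) -> \big[addb/false]_(x | K x) u x = false) ->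
  exists H : F -> bool, (forall x, H (a x) = H x) /\
    (forall x, H x (+) H (g x) = u x (+) u (g x)).
Proof.
move=> aK gK Hu.
pose n := #|F|.
pose del (x : F) : 'rV['F_2]_n := delta_mx 0 (enum_rank x).
pose A : 'M['F_2]_n := \matrix_i (del (enum_val i) + del (a (enum_val i))).
(* At a fixed point of [g] the row is a single basis vector, which forces annihilating functionals
   to vanish there. *)
pose B : 'M['F_2]_n := \matrix_i (if g (enum_val i) == enum_val i then
  del (enum_val i) else del (enum_val i) + del (g (enum_val i))).
pose U : 'rV['F_2]_n := \row_i (u (enum_val i))%:R.
have del_mul m (x : F) (C : 'M['F_2]_(n, m)) : del x *m C = row (enum_rank x) C.
  by rewrite rowE.
have [|UAB] := boolP (U <= A + B)%MS; last first.
  have [C0 AC BC] : [/\ U *m cokermx (A + B)%MS != 0, A *m cokermx (A + B)%MS = 0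
                      & B *m cokermx (A + B)%MS = 0].
    by split; [rewrite -submxE|apply/eqP; rewrite -submxE addsmxSl
       |apply/eqP; rewrite -submxE addsmxSr].
  move: (cokermx _) C0 AC BC => C C0 AC BC.
  have [j Cj] : exists j, (U *m C) 0 j != 0.
    apply/existsP; apply: contraR C0 => /existsPn UC; apply/eqP/rowP => j.
    by rewrite [RHS]mxE; apply/eqP; have := UC j; rewrite negbK.
  pose y x := C (enum_rank x) j.
  have ya x : y (a x) = y x.
    have : row (enum_rank x) (A *m C) 0 j = 0 by rewrite AC !mxE.
    rewrite row_mul rowK enum_rankK mulmxDl !del_mul !mxE.
    by move=> /F2_addr_eq0/esym.
  have yg x : if g x == x then y x = 0 else y (g x) = y x.
    have : row (enum_rank x) (B *m C) 0 j = 0 by rewrite BC !mxE.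
    rewrite row_mul rowK enum_rankK; case: eqP => _.
      by rewrite del_mul !mxE.
    by rewrite mulmxDl !del_mul !mxE => /F2_addr_eq0/esym.
  have uy : \big[addb/false]_(x | y x != 0) u x = false.
    apply: Hu => x; first by rewrite ya.
      by have := yg x; case: eqP => [->|_ ->].
    by move=> gx; have := yg x; rewrite gx eqxx => ->; rewrite eqxx.
  case/eqP: Cj; rewrite mxE.
  rewrite (reindex (@enum_rank F)) /=; last by apply: onW_bij; exact: enum_rank_bij.
  transitivity (\sum_(x | y x != 0) ((u x)%:R : 'F_2)).
    rewrite [RHS]big_mkcond /=; apply: eq_bigr => x _; rewrite mxE enum_rankK -/(y x).
    by case: ifPn => [|/negPn/eqP ->]; rewrite ?mulr0 // -[in LHS](F2_natr_neq0 (y x)) => ->; rewrite mulr1.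
  by rewrite -(big_morph (fun b : bool => b%:R : 'F_2) F2_natr_addb (id2 := false)) ?uy.
move=> /sub_addsmxP[[u1 u2] /= UE].
have A_inv x : (u1 *m A) 0 (enum_rank (a x)) = (u1 *m A) 0 (enum_rank x).
  have AE z : (u1 *m A) 0 (enum_rank z) = u1 0 (enum_rank z) + u1 0 (enum_rank (a z)).
    rewrite mxE (reindex (@enum_rank F)) /=; last by apply: onW_bij; exact: enum_rank_bij.
    under eq_bigr => t _.
      rewrite !mxE enum_rankK mulrDr !(inj_eq (@enum_rank_inj F)).
      over.
    rewrite big_split /= (bigD1 z) //= big1 ?addr0; last first.
      by move=> t tz; rewrite eq_sym (negPf tz) mulr0.
    rewrite [X in _ + X](bigD1 (a z)) //= big1 ?addr0; last first.
      by move=> t tz; rewrite -(inj_eq (inv_inj aK)) aK eq_sym (negPf tz) mulr0.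
    by rewrite aK !eqxx !mulr1.
  by rewrite !AE aK addrC.
have B_inv x : (u2 *m B) 0 (enum_rank (g x)) = (u2 *m B) 0 (enum_rank x).
  have [->//|gx] := eqVneq (g x) x.
  have BE z : g z != z -> (u2 *m B) 0 (enum_rank z) = u2 0 (enum_rank z) + u2 0 (enum_rank (g z)).
    move=> gz.
    rewrite mxE (reindex (@enum_rank F)) /=; last by apply: onW_bij; exact: enum_rank_bij.
    have Bent t : B (enum_rank t) (enum_rank z) =
        (t == z)%:R + ((g t != t) && (g t == z))%:R.
      rewrite mxE enum_rankK; case: (eqVneq (g t) t) => _; rewrite !mxE
        !(inj_eq (@enum_rank_inj F)) ?addr0 //= ![z == _]eq_sym //.
    under eq_bigr do rewrite Bent mulrDr.
    rewrite big_split /= (bigD1 z) //= big1 ?addr0 ?eqxx ?mulr1; last first.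
      by move=> t /negPf->; rewrite mulr0.
    rewrite [X in _ + X](bigD1 (g z)) //= big1 ?addr0 ?gK ?eqxx ?andbT; last first.
      move=> t tz; rewrite -(inj_eq (inv_inj gK)) gK eq_sym in tz.
      by rewrite [g t == z]eq_sym (negPf tz) andbF mulr0.
    by rewrite eq_sym gz mulr1.
  by rewrite !BE ?gK // 1?eq_sym // addrC.
have uE x : (u x)%:R = (u1 *m A) 0 (enum_rank x) + (u2 *m B) 0 (enum_rank x) :> 'F_2.
  by have := congr1 (fun D : 'rV_n => D 0 (enum_rank x)) UE; rewrite !mxE enum_rankK.
have F2_neq0_addb (x y : 'F_2) : (x + y != 0) = (x != 0) (+) (y != 0).
  by case: x y => [[|[|//]]] p [[|[|//]]] q.
have F2_bool (b : bool) : ((b%:R : 'F_2) != 0) = b by case: b.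
(* The [a]-invariant summand of [u] is the potential: its difference from [u] is [g]-invariant. *)
exists (fun x => (u1 *m A) 0 (enum_rank x) != 0); split=> x; first by rewrite A_inv.
rewrite -(F2_bool (u x)) -(F2_bool (u (g x))) !uE !F2_neq0_addb B_inv.
by rewrite addbACA addbb addbF.
Qed.

Section Involutions.
Variables (F : finType) (i : F -> F).
Hypothesis iK : involutive i.

(** [z] selects one element of each orbit of [i] in [K], so these orbits all have size two. *)
Lemma card_involution (K z : pred F) : (forall x, K (i x) = K x) ->
    (forall x, K x -> z (i x) = ~~ z x) ->
  (#|[pred x | K x]| = #|[pred x | K x && z x]|.*2)%N.
Proof.
move=> Ki zi.
rewrite -!sum1_card (bigID z) -addnn; congr addn.
rewrite (reindex_inj (inv_inj iK)); apply: eq_bigl => x; rewrite !inE Ki.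
by case Kx: (K x); rewrite //= zi ?Kx // negbK.
Qed.

Lemma big_addb_odd (K c : pred F) :
  \big[addb/false]_(x | K x) c x = odd #|[pred x | K x && c x]|.
Proof.
rewrite -sum1_card big_mkcond [in RHS]big_mkcond /=.
rewrite (big_morph odd oddD (erefl : odd 0 = false)).
by apply: eq_bigr => x _; rewrite inE; case: (K x); case: (c x).
Qed.

Lemma big_addb_involution (K c z : pred F) : (forall x, K (i x) = K x) ->
    (forall x, K x -> c (i x) = c x) -> (forall x, K x -> z (i x) = ~~ z x) ->
  \big[addb/false]_(x | K x) c x = false.
Proof.
move=> Ki ci zi.
rewrite big_addb_odd (@card_involution (fun x => K x && c x) z) ?odd_double //.
  by move=> x; rewrite Ki; case Kx: (K x); rewrite // ci.
by move=> x /andP[Kx _]; exact: zi.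
Qed.

Lemma big_int_involution (K : pred F) (c : F -> int) : (forall x, K (i x) = K x) ->
  (forall x, K x -> c (i x) = - c x) -> \sum_(x | K x) c x = 0.
Proof.
move=> Ki ci; have : \sum_(x | K x) c x = - \sum_(x | K x) c x.
  rewrite {1}(reindex_inj (inv_inj iK)) /= (eq_bigl K) //.
  by rewrite -sumrN; apply: eq_bigr => x /ci.
lia.
Qed.

End Involutions.

(** * Flags, and vertices as orbits of two involutions on them *)

Section Flags.
Variable M : fine_surface.

Definition flag : finType := (side M * 'I_2)%type.

Definition flag_corner (f : flag) : corner M := side_end f.1 f.2.

(** Within one triangle each corner lies on two sides; this table exchanges the two (side, end)
    pairs naming the same corner. Alternating [turn] and [cross] walks around a vertex of the
    surface. *)
Definition ord3_flip (p : 'I_3 * 'I_2) : 'I_3 * 'I_2 :=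
  match nat_of_ord p.1, nat_of_ord p.2 with
  | 0, 0 => (inord 2, inord 1) | 0, _ => (inord 1, inord 1)
  | 1, 0 => (inord 2, inord 0) | 1, _ => (inord 0, inord 1)
  | _, 0 => (inord 1, inord 0) | _, _ => (inord 0, inord 0)
  end%N.

Definition turn (f : flag) : flag :=
  let p := ord3_flip (f.1.2, f.2) in ((f.1.1, p.1), p.2).

Definition cross (f : flag) : flag := (glue f.1, f.2).

                                                                             
                                                             
(** Going round the triangle as 0, 1, 2, 0, the side of an incoming flag arrives at its end. Side 1
    runs from 0 to 2, against this cycle, hence the correction. *)
Definition incoming (f : flag) : bool :=
  (f.1.2 == inord 1) (+) (f.2 == inord 1).

Lemma ord32_ind (P : 'I_3 -> 'I_2 -> Prop) :
  P (inord 0) (inord 0) -> P (inord 0) (inord 1) ->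
  P (inord 1) (inord 0) -> P (inord 1) (inord 1) ->
  P (inord 2) (inord 0) -> P (inord 2) (inord 1) -> forall i k, P i k.
Proof.
by move=> P00 P01 P10 P11 P20 P21 i k; rewrite -(inord_val i) -(inord_val k);
  case: i k => [[|[|[|//]]] ?] [[|[|//]] ?].
Qed.

Lemma turnK : involutive turn.
Proof.
move=> [[t i] k]; move: i k.
by apply: ord32_ind; rewrite /turn /ord3_flip /= !inordK.
Qed.

Lemma crossK : involutive cross.
Proof. by move=> [s k]; rewrite /cross glueK. Qed.

Lemma incoming_turn f : incoming (turn f) = ~~ incoming f.
Proof.
case: f => [[t i] k]; move: i k.
by apply: ord32_ind; rewrite /incoming /turn /ord3_flip /= -!val_eqE /= !inordK.
Qed.

Lemma turn_corner f : flag_corner (turn f) = flag_corner f.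
Proof.
case: f => [[t i] k]; rewrite /flag_corner /side_end /=; congr (_, _).
move: i k; apply: ord32_ind; apply: val_inj;
  by rewrite /turn /ord3_flip /= !inordK.
Qed.

Lemma flag_corner_inj f f' :
  flag_corner f = flag_corner f' -> f' = f \/ f' = turn f.
Proof.
case: f f' => [[t i] k] [[t' i'] k']; rewrite /flag_corner /side_end /= => -[<-].
move: i k i' k'; apply: ord32_ind; apply: ord32_ind; rewrite /lift /= => ii';
  rewrite /turn /ord3_flip /= !inordK //; move: ii'; rewrite !inordK //; auto.
Qed.

Lemma flag_of_corner (c : corner M) : {f : flag | flag_corner f = c}.
Proof.
case: c => t [[|[|[|//]]] p].
- by exists ((t, inord 1), inord 0); rewrite /flag_corner /side_end; congr (_, _);
    apply: val_inj; rewrite /= !inordK.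
- by exists ((t, inord 0), inord 0); rewrite /flag_corner /side_end; congr (_, _);
    apply: val_inj; rewrite /= !inordK.
- by exists ((t, inord 0), inord 1); rewrite /flag_corner /side_end; congr (_, _);
    apply: val_inj; rewrite /= !inordK.
Qed.

Definition flag_vertex (f : flag) : vertex (skeleton M) :=
  \pi_{eq_quot (@corner_eqv M)} (flag_corner f).

Lemma turn_vertex f : flag_vertex (turn f) = flag_vertex f.
Proof. by rewrite /flag_vertex turn_corner. Qed.

Lemma cross_vertex f : flag_vertex (cross f) = flag_vertex f.
Proof.
apply/eqmodP; apply: connect1; apply/existsP; exists (glue f.1).
by apply/existsP; exists f.2; rewrite glueK !eqxx.
Qed.

(** Flags at one vertex are connected by [turn] and [cross], so invariant functions of flags are
    functions of the vertex. *)
Lemma flag_vertex_eq (T : Type) (K : flag -> T) :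
  (forall f, K (turn f) = K f) -> (forall f, K (cross f) = K f) ->
  forall f f', flag_vertex f = flag_vertex f' -> K f = K f'.
Proof.
move=> Kt Kc.
have same f f' : flag_corner f = flag_corner f' -> K f = K f'.
  by move=> /flag_corner_inj[->|->].
suff path f f' : corner_eqv (flag_corner f) (flag_corner f') -> K f = K f'.
  by move=> f f' /eqmodP; exact: path.
move=> /connectP[p]; elim: p f => [|c p IH] f /=; first by move=> _ /same ->.
move=> /andP[/existsP[s /existsP[k /andP[/eqP fs /eqP cs]]] pp] pl.
rewrite (same f (s, k)) // -Kc; apply: IH => //.
  by rewrite /flag_corner /= -cs.
by rewrite /flag_corner /= -cs.
Qed.

Lemma cross_fixed f : (cross f == f) = (glue f.1 == f.1).
Proof. by case: f => s k; rewrite /cross xpair_eqE eqxx andbT. Qed.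

Definition first_side (s : side M) := (enum_rank s < enum_rank (glue s))%N.

Lemma first_side_glue s : glue s != s -> first_side (glue s) = ~~ first_side s.
Proof.
move=> gs; rewrite /first_side glueK.
case: ltngtP => // /ord_inj /enum_rank_inj sg.
by case/eqP: gs.
Qed.

End Flags.

(** * Orientation, and separation of the surface by a walk *)

Definition cocycles_trivial (M : fine_surface) : Prop :=
  forall (w : side M -> bool) (H : corner M -> bool),
  (forall s k, H (side_end s k) (+) H (side_end (glue s) k) = w s) ->
  exists h : triangle M -> bool, forall s : side M, h s.1 (+) h (glue s).1 = w s.

Section Cochains.
Variable M : fine_surface.
Hypothesis trivM : cocycles_trivial M.

(** A local potential at an interior vertex exists when the total jump around it is zero. [u] splits
    each jump between the two sides of the gluing, so this total is the sum of [u] over the flags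
    there; around a boundary vertex there is no loop and no condition. *)
Lemma closed_cochain_trivial (u : flag M -> bool) (w : side M -> bool) :
    (forall f, u f (+) u (cross f) = w f.1) ->
    (forall K : pred (flag M), (forall f, K (turn f) = K f) ->
       (forall f, K (cross f) = K f) -> (forall f, glue f.1 = f.1 -> ~~ K f) ->
       \big[addb/false]_(f | K f) u f = false) ->
  exists h : triangle M -> bool, forall s : side M, h s.1 (+) h (glue s).1 = w s.
Proof.
move=> uw u_closed.
have [|H [Ht Hc]] := @two_involutions_potential (flag M) _ _ u (@turnK M) (@crossK M).
  move=> K Kt Kc Kfix; apply: u_closed => // f gf; apply: Kfix.
  by apply/eqP; rewrite cross_fixed gf.
pose Hcorner c := H (sval (flag_of_corner c)).
have HE f : Hcorner (flag_corner f) = H f.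
  rewrite /Hcorner; case: flag_of_corner => f' /= /esym/flag_corner_inj[->//|->].
  by rewrite Ht.
apply: (trivM (H := Hcorner)) => s k.
rewrite -[side_end (glue s) k]/(flag_corner (cross (s, k))).
by rewrite -[side_end s k]/(flag_corner (s, k)) !HE Hc uw.
Qed.

Definition middle (s : side M) : bool := s.2 == inord 1.

(** Glued sides must receive opposite induced orientations, the one induced on [s] being [eps]
    corrected by [middle s]. Around an interior vertex half of the flags are incoming and half lie
    on first sides, so the total obstruction is even. *)
Lemma orientable : exists eps : triangle M -> bool, forall s : side M,
  glue s != s -> eps s.1 (+) eps (glue s).1 = ~~ (middle s (+) middle (glue s)).
Proof.
pose w (s : side M) := (glue s != s) && ~~ (middle s (+) middle (glue s)).
pose u (f : flag M) := incoming f (+) first_side f.1.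
have [||eps epsP] := @closed_cochain_trivial u w.
- move=> [s k]; rewrite /u /w /incoming /cross /= -!/(middle _).
  have [gs|gs] := eqVneq (glue s) s; first by rewrite gs addbb.
  rewrite first_side_glue //.
  by case: (middle s); case: (middle _); case: (k == _); case: (first_side s).
- move=> K Kt Kc Kfix; rewrite big_split /= !big_addb_odd.
  have Kin := @card_involution _ _ (@turnK M) K (@incoming M) Kt (fun f _ => incoming_turn f).
  have Kfirst : #|[pred x | K x]| = (#|[pred x | K x && first_side x.1]|.*2)%N.
    apply: (card_involution (@crossK M)) => // f Kf; rewrite first_side_glue //.
    by apply/eqP => /Kfix; rewrite Kf.
  by move: Kfirst; rewrite Kin => /double_inj ->; rewrite addbb.
by exists eps => s gs; rewrite epsP /w gs.
Qed.

Implicit Types (p q : seq (dart (skeleton M))) (x y v : vertex (skeleton M)).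

Lemma dart_edge_ends (d : dart (skeleton M)) (T : Type) (op : T -> T -> T) (phi : _ -> T) :
  commutative op -> op (phi (dart_src d)) (phi (dart_tgt d)) = op (phi (src d.1)) (phi (tgt d.1)).
Proof. by move=> opC; case: d => e [] //=; rewrite opC. Qed.

(** Each passage is charged to the representative side of its edge, so on an interior edge the
    parity is the sum over both glued sides. *)
Definition traversals p (s : side M) : bool := odd (count (fun d => repr d.1 == s) p).

(** Telescoping: the mod 2 boundary of a walk consists of its two ends. *)
Lemma walk_degree (phi : vertex (skeleton M) -> bool) x p y : is_walk x p y ->
  \big[addb/false]_(f : flag M) (traversals p f.1 && phi (flag_vertex f)) =
  phi x (+) phi y.
Proof.
elim: p x => [|d p IH] x /=.
  by move=> ->; rewrite addbb big1 // => f _; rewrite /traversals.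
move=> [-> /IH]; set S := \big[_/_]_f _ => SE.
transitivity (\big[addb/false]_(f : flag M)
   ((repr d.1 == f.1) && phi (flag_vertex f)) (+) S).
  rewrite /S -big_split /=; apply: eq_bigr => f _.
  by rewrite /traversals /= oddD oddb andb_addl.
have -> : \big[addb/false]_(f : flag M) ((repr d.1 == f.1) && phi (flag_vertex f)) =
    phi (dart_src d) (+) phi (dart_tgt d).
  rewrite (dart_edge_ends _ _ addbC).
  rewrite -(pair_big xpredT xpredT (fun s k => (repr d.1 == s) && phi (flag_vertex (s, k)))) /=.
  rewrite (bigD1 (repr d.1)) //= [X in _ (+) X]big1 ?addbF; last first.
    by move=> s sd; rewrite big1 // => k _; rewrite eq_sym (negPf sd).
  by rewrite !big_ord_recl big_ord0 addbF eqxx /=; congr (phi _ (+) phi (flag_vertex (_, _))); apply: val_inj.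
by rewrite SE -addbA; congr addb; rewrite addbA addbb.
Qed.

Definition walk_vertices x p : seq {eq_quot (@corner_eqv M)} :=
  x :: map (@dart_tgt (skeleton M)) p.

Lemma traversals_vertices x p y (f : flag M) : is_walk x p y ->
  traversals p f.1 -> (flag_vertex f : {eq_quot (@corner_eqv M)}) \in walk_vertices x p.
Proof.
elim: p x => [//|d p IH] x /= [-> wp].
have sub : {subset walk_vertices (dart_tgt d) p <= walk_vertices (dart_src d) (d :: p)}.
  by move=> v; rewrite /walk_vertices /= !inE => ->; rewrite orbT.
rewrite /traversals /= oddD; have [df _|_] := eqVneq (repr d.1) f.1; last first.
  by move=> /(IH _ wp) /sub.
rewrite /walk_vertices /= !inE.
clear IH; case: f df => s k /= <-.
have : flag_vertex (repr d.1, k) = src d.1 \/ flag_vertex (repr d.1, k) = tgt d.1.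
  case: k => [[|[|//]]] k2; [left|right]; congr (\pi_{eq_quot _} (side_end _ _)); exact: val_inj.
by case: d {wp sub} => e [] /=; case=> ->; rewrite eqxx ?orbT.
Qed.

Definition boundary_point v := exists2 f : flag M, glue f.1 = f.1 & flag_vertex f = v.

                                                                         
                                                           
(** The walk has even degree at every interior vertex, because its ends are on the boundary; hence
    crossing parity is a coboundary, of the colouring [h]. The second clause says that along the
    boundary the colour, corrected where the walk itself uses boundary sides, changes exactly at the
    ends of the walk. *)
Lemma walk_cut x p y : is_walk x p y -> boundary_point x -> boundary_point y ->
  exists h : triangle M -> bool,
    (forall s : side M, h s.1 (+) h (glue s).1 = traversals p s (+) traversals p (glue s)) /\
    (forall v, \big[addb/false]_(f : flag M | (glue f.1 == f.1) && (flag_vertex f == v))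
        (h f.1.1 (+) traversals p f.1) = (x == v) (+) (y == v)).
Proof.
move=> wp [fx fx_fix fx_v] [fy fy_fix fy_v].
have [||h hE] := @closed_cochain_trivial (fun f => traversals p f.1)
    (fun s => traversals p s (+) traversals p (glue s)).
- by [].
- move=> K Kt Kc Kfix.
  pose phi v := K (sval (flag_of_corner (repr v))).
  have phiE f : phi (flag_vertex f) = K f.
    apply: flag_vertex_eq => //; case: flag_of_corner => f' /= f'E.
    by rewrite /flag_vertex f'E reprK.
  have := walk_degree phi wp; rewrite -fx_v -fy_v !phiE.
  rewrite (negPf (Kfix _ fx_fix)) (negPf (Kfix _ fy_fix)) addbb => pK.
  rewrite -[RHS]pK big_mkcond /=; apply: eq_bigr => f _; rewrite phiE.
  by case: (K f); rewrite ?andbT ?andbF.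
exists h; split=> // v.
have vt f : (flag_vertex (turn f) == v) = (flag_vertex f == v) by rewrite turn_vertex.
have vc f : (flag_vertex (cross f) == v) = (flag_vertex f == v) by rewrite cross_vertex.
have sum_h : \big[addb/false]_(f : flag M | flag_vertex f == v) h f.1.1 = false.
  by apply: (big_addb_involution (@turnK M) (z := @incoming M)) => // f _; rewrite incoming_turn.
have sum_p : \big[addb/false]_(f : flag M | flag_vertex f == v) traversals p f.1 =
    (x == v) (+) (y == v).
  rewrite -(walk_degree (fun z => z == v) wp) [LHS]big_mkcond /=; apply: eq_bigr => f _.
  by case: (_ == v); rewrite ?andbT ?andbF.
have : \big[addb/false]_(f : flag M | flag_vertex f == v) (h f.1.1 (+) traversals p f.1)
    = (x == v) (+) (y == v) by rewrite big_split /= sum_h sum_p.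
(* [h] plus traversal parity takes equal values on glued sides, so interior flags cancel in pairs
   under [cross] and only boundary flags remain. *)
rewrite (bigID (fun f : flag M => glue f.1 == f.1)) /=.
rewrite [X in _ (+) X](_ : _ = false); last first.
  apply: (big_addb_involution (@crossK M) (z := fun f => first_side f.1)).
  - by move=> f; rewrite vc /= glueK [f.1 == _]eq_sym.
  - move=> f _; have := hE f.1; rewrite /=.
    by case: (h _); case: (h _); case: (traversals _ _); case: (traversals _ _).
  - by move=> f /andP[_ gf]; rewrite first_side_glue.
by rewrite addbF => <-; apply: eq_bigl => f; rewrite andbC.
Qed.

End Cochains.

(** * The boundary cycle: walks with interleaved ends, and coherent orientation *)

Section Boundary.
Variables (M : fine_surface) (n : nat) (o : 'I_n -> bool).
Local Notation C := (cycle_graph o).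
Variables (fV : vertex C -> vertex (skeleton M)) (fE : edge C -> edge (skeleton M)).
Hypothesis iso : boundary_iso fV fE.

Definition boundary_side (i : 'I_n) : side M := repr (fE i : {eq_quot (@side_eqv M)}).

Lemma repr_pi_fixed (s : side M) : glue s = s -> repr (\pi_{eq_quot (@side_eqv M)} s) = s.
Proof.
move=> gs; have /eqmodP : s = repr (\pi_{eq_quot (@side_eqv M)} s) %[mod {eq_quot (@side_eqv M)}].
  by rewrite reprK.
by rewrite /= /side_eqv gs orbb => /eqP.
Qed.

Lemma boundary_side_fixed i : glue (boundary_side i) = boundary_side i.
Proof.
have [_ [_ /(_ (fE i))[_ bE]] _] := iso.
have [s sE gs] := bE (ex_intro _ i erefl).
by rewrite /boundary_side sE repr_pi_fixed.
Qed.

Lemma boundary_side_inj : injective boundary_side.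
Proof.
have [_ [fE_inj _] _] := iso.
move=> i j ij; apply: fE_inj.
rewrite -[fE i](@reprK _ {eq_quot (@side_eqv M)}).
by rewrite -[fE j](@reprK _ {eq_quot (@side_eqv M)}) -/(boundary_side i) ij.
Qed.

Lemma boundary_side_onto s : glue s = s -> exists i, s = boundary_side i.
Proof.
move=> gs; have [_ [_ bE] _] := iso.
have [i iE] := (bE (\pi_{eq_quot (@side_eqv M)} s)).1 (ex_intro2 _ _ s erefl gs).
by exists i; rewrite /boundary_side iE repr_pi_fixed.
Qed.

Lemma boundary_side_src i : flag_vertex (boundary_side i, ord0) = fV (@src C i).
Proof. by have [_ _ /(_ i)[<- _]] := iso. Qed.

Lemma boundary_side_tgt i : flag_vertex (boundary_side i, ord_max) = fV (@tgt C i).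
Proof. by have [_ _ /(_ i)[_ <-]] := iso. Qed.

Lemma boundary_point_fV j : boundary_point (fV j).
Proof.
case oj : (o j).
  exists (boundary_side j, ord0); first exact: boundary_side_fixed.
  by rewrite boundary_side_src /= oj.
exists (boundary_side j, ord_max); first exact: boundary_side_fixed.
by rewrite boundary_side_tgt /= oj.
Qed.

Lemma big_boundary_flags (T : Type) (idx : T) (op : Monoid.com_law idx)
    (Phi : flag M -> T) (P : pred (flag M)) :
  \big[op/idx]_(f : flag M | (glue f.1 == f.1) && P f) Phi f =
  \big[op/idx]_(i < n) op (if P (boundary_side i, ord0) then Phi (boundary_side i, ord0) else idx)
     (if P (boundary_side i, ord_max) then Phi (boundary_side i, ord_max) else idx).
Proof.
rewrite big_mkcondr /=.
transitivity (\big[op/idx]_(f : flag M | (glue f.1 == f.1) && xpredT f.2)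
    if P (f.1, f.2) then Phi (f.1, f.2) else idx).
  by apply: eq_big => -[s k]; rewrite ?andbT.
rewrite -(pair_big (fun s => glue s == s) xpredT
  (fun s k => if P (s, k) then Phi (s, k) else idx)) /=.
transitivity (\big[op/idx]_(s in [set boundary_side i | i : 'I_n])
    \big[op/idx]_(k < 2) (if P (s, k) then Phi (s, k) else idx)).
  apply: eq_bigl => s; apply/eqP/imsetP => [/boundary_side_onto[i ->]|[i _ ->]].
    by exists i.
  exact: boundary_side_fixed.
rewrite big_imset /=; last by move=> i j _ _; exact: boundary_side_inj.
apply: eq_bigr => i _; rewrite !big_ord_recl big_ord0 Monoid.mulm1.
by have -> : lift ord0 ord0 = ord_max :> 'I_2 by apply: val_inj.
Qed.

Lemma ordS_eq (i j : 'I_n) : (ordS i == j) = (i == ord_pred j).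
Proof. by apply/eqP/eqP => [<-|->]; rewrite ?ordSK ?ord_predK. Qed.

Lemma fV_eq (i j : 'I_n) :
  (fV i == fV j :> {eq_quot (@corner_eqv M)}) = (i == j).
Proof. by have [[fV_inj _] _ _] := iso; exact: inj_eq. Qed.

(** The boundary passes through [fV j] once, along its sides [j] and [j - 1]. *)
Lemma big_addb_boundary (b : side M -> bool) (j : 'I_n) :
  \big[addb/false]_(f : flag M | (glue f.1 == f.1) && (flag_vertex f == fV j)) b f.1 =
  b (boundary_side j) (+) b (boundary_side (ord_pred j)).
Proof.
rewrite big_boundary_flags /=.
transitivity (\big[addb/false]_(i < n) ((if i == j then b (boundary_side i) else false)
   (+) (if i == ord_pred j then b (boundary_side i) else false))).
  apply: eq_bigr => i _; rewrite boundary_side_src boundary_side_tgt !fV_eq -ordS_eq.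
  by rewrite /=; case: (o i); rewrite // addbC.
by rewrite big_split /= -!big_mkcond /= !big_pred1_eq.
Qed.

(** Colour the triangles by [walk_cut] for [p]. If [q] avoids [p], the colour is constant along [q];
    on the boundary arc from [i2] to [i4] it changes exactly once, at [i3]. *)
Lemma interleaved_walks_meet (trivM : cocycles_trivial M) (i1 i2 i3 i4 : 'I_n) p q :
    (i1 < i2)%N -> (i2 < i3)%N -> (i3 < i4)%N ->
    is_walk (fV i1) p (fV i3) -> is_walk (fV i2) q (fV i4) ->
  exists2 v, v \in walk_vertices (fV i1) p & v \in walk_vertices (fV i2) q.
Proof.
move=> i12 i23 i34 wp wq; apply: contrapT => avoid.
have {}avoid v : v \in walk_vertices (fV i2) q -> v \notin walk_vertices (fV i1) p.
  by move=> vq; apply/negP => vp; apply: avoid; exists v.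
have [h [hE hv]] := walk_cut trivM wp (boundary_point_fV i1) (boundary_point_fV i3).
pose b (s : side M) := h s.1 (+) traversals p s.
have b_step (j : 'I_n) : b (boundary_side j) (+) b (boundary_side (ord_pred j)) =
    (i1 == j) (+) (i3 == j).
  by rewrite -big_addb_boundary /b hv !fV_eq.
have b_arc (m : nat) (mn : (m < n)%N) : (i2 <= m)%N -> (m <= i4)%N ->
    b (boundary_side (Ordinal mn)) = b (boundary_side i2) (+) (i3 <= m)%N.
  elim: m mn => [|m IH] mn.
    rewrite leqn0 => /eqP i20; move: i23; rewrite leqn0 => i23 _.
    have -> : Ordinal mn = i2 by apply: val_inj; rewrite /= i20.
    by case: eqP i23 => [->|_ _]; rewrite ?addbF.
  rewrite leq_eqVlt => /orP[/eqP i2m _|i2m mi4].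
    have -> : Ordinal mn = i2 by apply: val_inj; rewrite /= -i2m.
    by rewrite -i2m leqNgt i23 addbF.
  have := b_step (Ordinal mn).
  have -> : ord_pred (Ordinal mn) = Ordinal (ltnW mn : (m < n)%N).
    by apply: val_inj; rewrite /= modnDr modn_small // ltnW.
  rewrite IH //; last exact: ltnW.
  rewrite -!val_eqE /= (_ : (i1 == m.+1 :> nat) = false); last by apply/eqP; lia.
  rewrite addFb => bm; rewrite -[LHS](addbK (b (boundary_side i2) (+) (i3 <= m)%N)) bm.
  rewrite (leq_eqVlt i3 m.+1) ltnS.
  by case: eqP => [->|]; rewrite ?ltnn; case: (b _); case: (i3 <= m)%N.
(* At a vertex of [q] no incident side is traversed by [p], so all triangles around it have one
   colour. *)
have hconst (f f' : flag M) : flag_vertex f \in walk_vertices (fV i2) q ->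
    flag_vertex f = flag_vertex f' -> h f.1.1 = h f'.1.1 /\ ~~ traversals p f.1.
  move=> fq ff'; have untrav f0 : flag_vertex f0 = flag_vertex f -> ~~ traversals p f0.1.
    move=> f0f; apply/negP => /(traversals_vertices (f := f0) wp).
    by rewrite f0f; exact/negP/avoid.
  split; last exact: untrav.
  pose K (f0 : flag M) := (flag_vertex f0 == flag_vertex f) && h f0.1.1.
  have : K f = K f'.
    apply: flag_vertex_eq => // f0; rewrite /K ?turn_vertex // cross_vertex.
    case: eqP => //= f0f; have := hE f0.1.
    rewrite (negPf (untrav _ f0f)) (negPf (untrav (cross f0) _)) ?cross_vertex //=.
    by case: (h _); case: (h _).
  by rewrite /K -ff' eqxx.
have ends (d : dart (skeleton M)) : exists k k', dart_src d = flag_vertex (repr d.1, k)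
    /\ dart_tgt d = flag_vertex (repr d.1, k').
  by case: d => e []; [exists ord0, ord_max|exists ord_max, ord0].
have hwalk x y q' (f f' : flag M) : is_walk x q' y ->
    {subset walk_vertices x q' <= walk_vertices (fV i2) q} ->
    flag_vertex f = x -> flag_vertex f' = y -> h f.1.1 = h f'.1.1.
  elim: q' x f => [|d q' IH] x f /=.
    move=> xy sub fx f'y; have [||//] := hconst f f'; last by rewrite fx f'y.
    by apply: sub; rewrite fx mem_head.
  move=> [xd wq'] sub fx f'y; have [k [k' [dk dk']]] := ends d.
  have [||-> _] := hconst f (repr d.1, k).
  - by apply: sub; rewrite fx mem_head.
  - by rewrite fx xd.
  rewrite -[(repr d.1, k).1.1]/((repr d.1, k').1.1); apply: IH wq' _ _ f'y => //.
  by move=> v vq'; apply: sub; rewrite /walk_vertices /= inE vq' orbT.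
have last_in x q' y : is_walk x q' y -> y \in walk_vertices x q'.
  elim: q' x => [|d q' IH] x /=; first by move=> ->; rewrite mem_head.
  by move=> [_ /IH yq']; rewrite /walk_vertices /= inE yq' orbT.
have bflag (i : 'I_n) : exists2 f : flag M, f.1 = boundary_side i & flag_vertex f = fV i.
  case oi : (o i).
    by exists (boundary_side i, ord0); rewrite // boundary_side_src /= oi.
  by exists (boundary_side i, ord_max); rewrite // boundary_side_tgt /= oi.
have [f2 f2s f2v] := bflag i2; have [f4 f4s f4v] := bflag i4.
have [||_ t2] := hconst f2 f2; [by rewrite f2v mem_head|by []|].
have [||_ t4] := hconst f4 f4; [by rewrite f4v; exact: last_in|by []|].
have := b_arc i4 (ltn_ord i4) (ltnW (ltn_trans i23 i34)) (leqnn _).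
have -> : Ordinal (ltn_ord i4) = i4 by apply: val_inj.
rewrite (ltnW i34) /b -f2s -f4s (negPf t2) (negPf t4) !addbF.
rewrite (hwalk _ _ _ f2 f4 wq) //.
by case: (h _).
Qed.

(** Sum the signs of all flags at a boundary vertex: [turn] cancels the total and [cross] the
    interior flags. The two boundary flags left must have opposite signs, so the induced orientation
    continues along the cycle. *)
Lemma boundary_coherent (eps : triangle M -> bool)
    (epsP : forall s : side M, glue s != s ->
       eps s.1 (+) eps (glue s).1 = ~~ (middle s (+) middle (glue s))) :
  exists th : bool, forall i : 'I_n,
    eps (boundary_side i).1 (+) middle (boundary_side i) = th (+) o i.
Proof.
pose Phi (f : flag M) : int := (-1) ^+ (eps f.1.1 (+) incoming f).
pose c (i : 'I_n) : int := (-1) ^+ (eps (boundary_side i).1 (+) middle (boundary_side i) (+) o i).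
have c_step j : c j = c (ord_pred j).
  have : \sum_(f : flag M | flag_vertex f == fV j) Phi f = 0.
    apply: (big_int_involution (@turnK M)) => f; first by rewrite turn_vertex.
    by move=> _; rewrite /Phi incoming_turn addbN signrN.
  rewrite (bigID (fun f : flag M => glue f.1 == f.1)) /=.
  rewrite [X in _ + X](_ : _ = 0) ?addr0; last first.
    apply: (big_int_involution (@crossK M)) => f.
      by rewrite cross_vertex /= glueK [f.1 == _]eq_sym.
    move=> /andP[_ gf]; rewrite /Phi -signrN; congr (_ ^+ (nat_of_bool _)).
    have := epsP _ gf; rewrite /incoming /cross /= -!/(middle _).
    by case: (eps _); case: (eps _); case: (middle _); case: (middle _); case: (_ == _).
  under eq_bigl do rewrite andbC.
  rewrite big_boundary_flags /=.
  have -> : \sum_(i < n) ((if flag_vertex (boundary_side i, ord0) == fV j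
        then Phi (boundary_side i, ord0) else 0) +
      (if flag_vertex (boundary_side i, ord_max) == fV j
        then Phi (boundary_side i, ord_max) else 0)) =
    \sum_(i < n) (- (if i == j then c i else 0) + (if i == ord_pred j then c i else 0)).
    apply: eq_bigr => i _; rewrite boundary_side_src boundary_side_tgt !fV_eq -ordS_eq.
    have i0 : incoming (boundary_side i, ord0) = middle (boundary_side i).
      by rewrite /incoming /= -/(middle _) -val_eqE /= inordK ?addbF.
    have i1 : incoming (boundary_side i, ord_max) = ~~ middle (boundary_side i).
      by rewrite /incoming /= -/(middle _) -val_eqE /= inordK // addbT.
    rewrite /Phi i0 i1 /c /=; case: (o i); rewrite ?addbT ?addbF ?addbN !signrN.
      by rewrite -[X in - X + _]opprK; case: eqP; case: eqP; rewrite ?oppr0 ?opprK.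
    by rewrite addrC; case: eqP; case: eqP; rewrite ?oppr0.
  rewrite big_split /= sumrN -!big_mkcond /= !big_pred1_eq => /eqP.
  by rewrite addrC subr_eq0 => /eqP.
have [n0|n_gt0] := posnP n; first by exists false => i; have := ltn_ord i; rewrite {2}n0.
pose i0 : 'I_n := Ordinal n_gt0.
have c_const i : c i = c i0.
  case: i => m; elim: m => [|m IH] mn; first by congr c; apply: val_inj.
  rewrite c_step -(IH (ltnW mn)); congr c; apply: val_inj.
  by rewrite /= modnDr modn_small // ltnW.
exists (eps (boundary_side i0).1 (+) middle (boundary_side i0) (+) o i0) => i.
by have /signr_inj <- := c_const i; rewrite addbK.
Qed.

End Boundary.

                                           

(** * Distances, and geodesics that meet *)

Section Distance.
Variable G : fine_graph.
Implicit Types (x y z : vertex G) (p q : seq (dart G)) (d : dart G) (e : edge G).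

Definition reachable x y : Prop := exists p, is_walk x p y.

                                                                
(** The default 0 is harmless in [ndist_edge]: the two ends of an edge are reachable or unreachable
    together. *)
Definition ndist x y : nat := odflt 0%N (dist x y).

Definition rev_walk p : seq (dart G) := rev (map (@dart_rev G) p).

Lemma is_walk_cat x p y q z : is_walk x p y -> is_walk y q z -> is_walk x (p ++ q) z.
Proof. by elim: p x => [|d p IH] x /=; [move=> ->|move=> [-> /IH wp] /wp]. Qed.

Lemma walk_length_cat p q : walk_length (p ++ q) = (walk_length p + walk_length q)%N.
Proof. by rewrite /walk_length big_cat. Qed.

Lemma is_walk_rev x p y : is_walk x p y -> is_walk y (rev_walk p) x.
Proof.
elim: p x => [|d p IH] x /=; first by move=> ->.
move=> [-> /IH wp]; rewrite /rev_walk /= rev_cons -cats1.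
by apply: is_walk_cat wp _; case: d => e [].
Qed.

Lemma reachable_refl x : reachable x x.
Proof. by exists [::]. Qed.

Lemma reachable_sym x y : reachable x y -> reachable y x.
Proof. by move=> [p /is_walk_rev]; exists (rev_walk p). Qed.

Lemma reachable_trans y x z : reachable x y -> reachable y z -> reachable x z.
Proof. by move=> [p wp] [q wq]; exists (p ++ q); exact: is_walk_cat wq. Qed.

Lemma reachable_dart d : reachable (dart_src d) (dart_tgt d).
Proof. by exists [:: d]. Qed.

Lemma reachable_edge e : reachable (src e) (tgt e).
Proof. exact: (reachable_dart (e, true)). Qed.

Lemma ndist_geodesic x y : reachable x y ->
  exists2 p, is_walk x p y & walk_length p = ndist x y.
Proof.
move=> [p wp]; rewrite /ndist /dist; case: pselect => [ex|[]]; last first.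
  by exists (walk_length p); apply/asboolP; exists p.
by case: ex_minnP => k /asboolP[q wq <-] _; exists q.
Qed.

Lemma ndist_le x p y : is_walk x p y -> (ndist x y <= walk_length p)%N.
Proof.
move=> wp; rewrite /ndist /dist; case: pselect => [ex|[]]; last first.
  by exists (walk_length p); apply/asboolP; exists p.
by case: ex_minnP => k _; apply; apply/asboolP; exists p.
Qed.

Lemma dist_reachable x y : reachable x y -> dist x y = Some (ndist x y).
Proof.
move=> [p wp]; rewrite /ndist /dist; case: pselect => [ex //|[]].
by exists (walk_length p); apply/asboolP; exists p.
Qed.

Lemma dist_Some x y k : dist x y = Some k -> reachable x y.
Proof.
rewrite /dist; case: pselect => // ex _; case: ex => l /asboolP[p wp _].
by exists p.
Qed.

Lemma ndist_unreachable x y : ~ reachable x y -> ndist x y = 0%N.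
Proof.
move=> nxy; rewrite /ndist /dist; case: pselect => // ex; case: nxy.
by case: ex => l /asboolP[p wp _]; exists p.
Qed.

Lemma ndistxx x : ndist x x = 0%N.
Proof.
apply/eqP; rewrite -leqn0; have := @ndist_le x [::] x erefl.
by rewrite /walk_length big_nil.
Qed.

Lemma ndist_dart x d : reachable x (dart_src d) ->
  (ndist x (dart_tgt d) <= ndist x (dart_src d) + dart_length d)%N.
Proof.
move=> /ndist_geodesic[p wp <-].
have := @ndist_le x (p ++ [:: d]) (dart_tgt d).
by rewrite walk_length_cat /walk_length big_seq1; apply; apply: is_walk_cat wp _.
Qed.

Lemma ndist_edge x e :
  (ndist x (src e) <= ndist x (tgt e) <= ndist x (src e) + 1)%N.
Proof.
have [xe|nxe] := pselect (reachable x (src e)).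
  rewrite (ndist_dart (d := (e, true))) // andbT.
  have := @ndist_dart x (e, false); rewrite addn0; apply.
  exact: reachable_trans (reachable_edge e).
rewrite !ndist_unreachable // => xe; apply: nxe.
exact: reachable_trans (reachable_sym (reachable_edge e)).
Qed.

End Distance.

Section SkeletonWalks.
Variable M : fine_surface.
Implicit Types (p q : seq (dart (skeleton M))) (x y v : vertex (skeleton M)).

Lemma walk_vertices_cat x p y q v : v \in walk_vertices x (p ++ q) ->
  (v \in walk_vertices x p) || (v \in walk_vertices y q).
Proof.
rewrite /walk_vertices map_cat !inE mem_cat.
by rewrite orbA => /orP[->//|->]; rewrite !orbT.
Qed.

Lemma walk_vertices_rev x p y : is_walk x p y ->
  walk_vertices y (rev_walk p) = rev (walk_vertices x p).
Proof.
elim: p x => [|d p IH] x /=; first by move=> ->.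
move=> [-> /IH wp]; rewrite /walk_vertices /rev_walk /= !rev_cons map_rcons -rcons_cons.
rewrite -[_ :: map _ _]/(walk_vertices y (rev_walk p)) wp /walk_vertices rev_cons.
by congr rcons; case: d {wp} => e [].
Qed.

Lemma walk_split x p y v : is_walk x p y -> v \in walk_vertices x p ->
  exists p1 p2, [/\ is_walk x p1 v, is_walk v p2 y & walk_length p = (walk_length p1 + walk_length p2)%N].
Proof.
elim: p x => [|d p IH] x.
  move=> xy; rewrite /walk_vertices inE => /eqP ->; exists [::], [::].
  by split=> //; rewrite /walk_length big_nil.
move=> wp; rewrite /walk_vertices inE => /orP[/eqP ->|vp].
  by exists [::], (d :: p); split=> //; rewrite -walk_length_cat.
move: wp => /= [xd wp]; have [p1 [p2 [w1 w2 pE]]] := IH _ wp vp.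
exists (d :: p1), p2; split=> //.
by rewrite /walk_length !big_cons -addnA; congr addn; exact: pE.
Qed.

                                                      
(** Exchange the tails of the two walks at their common vertex. *)
Lemma crossing_walks_ndist x y x' y' p q v : is_walk x p y -> is_walk x' q y' ->
    v \in walk_vertices x p -> v \in walk_vertices x' q ->
  (ndist x y' + ndist x' y <= walk_length p + walk_length q)%N.
Proof.
move=> wp wq vp vq.
have [p1 [p2 [p1v p2v ->]]] := walk_split wp vp.
have [q1 [q2 [q1v q2v ->]]] := walk_split wq vq.
have := ndist_le (is_walk_cat p1v q2v); have := ndist_le (is_walk_cat q1v p2v).
by rewrite !walk_length_cat; lia.
Qed.

Variables (n : nat) (o : 'I_n -> bool).
Local Notation C := (cycle_graph o).
Variables (fV : vertex C -> vertex (skeleton M)) (fE : edge C -> edge (skeleton M)).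
Hypothesis iso : boundary_iso fV fE.
Hypothesis trivM : cocycles_trivial M.
Hypothesis fV_reachable : forall i j, reachable (fV i) (fV j).

Definition farther (e : edge (skeleton M)) (i : 'I_n) : bool :=
  ndist (fV i) (tgt e) == (ndist (fV i) (src e)).+1.

(** Otherwise join [i1] to [i3] and [i2] to [i4] by geodesics through opposite ends of [e]. These
    walks must meet, although geodesics from sources of different kinds cannot. *)
Lemma farther_not_interleaved e (i1 i2 i3 i4 : 'I_n) :
    (i1 < i2)%N -> (i2 < i3)%N -> (i3 < i4)%N ->
  farther e i1 = farther e i3 -> farther e i2 = farther e i4 ->
  farther e i1 = farther e i2.
Proof.
move=> i12 i23 i34 e13 e24; have [//|/eqP e12] := pselect (farther e i1 = farther e i2); exfalso.
have [r1|nr1] := pselect (reachable (fV i1) (src e)); last first.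
  have f0 i : farther e i = false.
    have nr : ~ reachable (fV i) (src e).
      by move=> r; apply: nr1; apply: reachable_trans (fV_reachable i1 i) r.
    rewrite /farther !ndist_unreachable // => r; apply: nr.
    exact: reachable_trans r (reachable_sym (reachable_edge e)).
  by rewrite !f0 eqxx in e12.
(* With these targets, exchanging tails would save 1: a farther source reaches [src e] more cheaply
   than [tgt e], while for the other kind both ends are equally far. *)
pose goal i := if farther e i then src e else tgt e.
have rg i : reachable (fV i) (goal i).
  have r : reachable (fV i) (src e) by apply: reachable_trans (fV_reachable i i1) r1.
  by rewrite /goal; case: farther => //; apply: reachable_trans r (reachable_edge e).
have /choice[P PP] : forall i, exists p, is_walk (fV i) p (goal i) /\
    walk_length p = ndist (fV i) (goal i).
  by move=> i; have [p wp lp] := ndist_geodesic (rg i); exists p.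
have Pw i : is_walk (fV i) (P i) (goal i) by case: (PP i).
have Pl i : walk_length (P i) = ndist (fV i) (goal i) by case: (PP i).
have nocross i j v : farther e i != farther e j ->
    v \in walk_vertices (fV i) (P i) -> v \notin walk_vertices (fV j) (P j).
  move=> eij vi; apply/negP => vj.
  have := crossing_walks_ndist (Pw i) (Pw j) vi vj.
  have := ndist_edge (fV i) e; have := ndist_edge (fV j) e.
  move: eij; rewrite !Pl /goal /farther.
  by case: (ndist (fV i) (tgt e) =P _) => ei; case: (ndist (fV j) (tgt e) =P _) => ej // _;
    cbv iota; lia.
have g13 : goal i1 = goal i3 by rewrite /goal e13.
have g24 : goal i2 = goal i4 by rewrite /goal e24.
have w13 : is_walk (fV i1) (P i1 ++ rev_walk (P i3)) (fV i3).
  by apply: is_walk_cat (Pw i1) _; rewrite g13; exact: is_walk_rev.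
have w24 : is_walk (fV i2) (P i2 ++ rev_walk (P i4)) (fV i4).
  by apply: is_walk_cat (Pw i2) _; rewrite g24; exact: is_walk_rev.
have [v v13 v24] := interleaved_walks_meet iso trivM i12 i23 i34 w13 w24.
have := walk_vertices_cat (goal i3) v13.
rewrite (walk_vertices_rev (Pw i3)) mem_rev => {}v13.
have := walk_vertices_cat (goal i4) v24.
rewrite (walk_vertices_rev (Pw i4)) mem_rev => {}v24.
have e14 : farther e i1 != farther e i4 by rewrite -e24.
have e32 : farther e i3 != farther e i2 by rewrite -e13.
have e34 : farther e i3 != farther e i4 by rewrite -e13 -e24.
by case/orP: v13 => v13; case/orP: v24 => v24; move: v24; apply/negP;
  apply: nocross v13.
Qed.

End SkeletonWalks.

                       

(** * Cyclic intervals and winding numbers *)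

Section CyclicIntervals.
Variable n : nat.

Definition not_interleaved (e : 'I_n -> bool) : Prop :=
  forall i1 i2 i3 i4 : 'I_n, (i1 < i2)%N -> (i2 < i3)%N -> (i3 < i4)%N ->
  e i1 = e i3 -> e i2 = e i4 -> e i1 = e i2.

Lemma not_interleavedC e : not_interleaved e -> not_interleaved (fun i => ~~ e i).
Proof.
move=> ne i1 i2 i3 i4 i12 i23 i34 /negb_inj e13 /negb_inj e24.
by rewrite (ne _ _ _ _ i12 i23 i34 e13 e24).
Qed.

Lemma ordS_val (i : 'I_n) : ordS i = (if i.+1 == n then 0 else i.+1)%N :> nat.
Proof.
rewrite /=; case: eqP => [->|ni]; first by rewrite modnn.
by rewrite modn_small // ltn_neqAle; apply/andP; split=> //; apply/eqP.
Qed.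

(** Two entries, at [i] and [j], would make [i], [ordS i], [j], [ordS j] an alternating
    quadruple. *)
Lemma single_entry e : not_interleaved e ->
  (\sum_(i < n) (~~ e i && e (ordS i)) <= 1)%N.
Proof.
move=> ne.
have lt_absurd (i j : 'I_n) : (i < j)%N -> ~~ e i && e (ordS i) -> ~~ e j && e (ordS j) -> False.
  move=> ij /andP[ei eSi] /andP[ej eSj].
  have Si : ordS i = i.+1 :> nat.
    by rewrite ordS_val; case: eqP => // Sin; have := ltn_ord j; lia.
  have Sij : (ordS i < j)%N.
    rewrite ltn_neqAle Si ij andbT; apply/eqP => Sj.
    have SiE : ordS i = j by apply: ord_inj; rewrite Si.
    by rewrite -SiE eSi in ej.
  have iSi : (i < ordS i)%N by rewrite Si.
  (* If [j] is the last index, its successor wraps to 0 and becomes the first of the four. *)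
  have := ordS_val j; case: eqP => [Sj|_] SjE.
    have Sj_i : (ordS j < i)%N.
      rewrite SjE lt0n; apply/eqP => i0.
      have SjE' : ordS j = i by apply: ord_inj; rewrite SjE i0.
      by rewrite -SjE' eSj in ei.
    have := ne _ _ _ _ Sj_i iSi Sij; rewrite eSj (negPf ei) eSi (negPf ej).
    by move=> /(_ erefl erefl).
  have jSj : (j < ordS j)%N by rewrite SjE.
  have := ne _ _ _ _ iSi Sij jSj; rewrite eSj (negPf ei) eSi (negPf ej).
  by move=> /(_ erefl erefl).
have [i ei|none] := pickP (fun i => ~~ e i && e (ordS i)); last first.
  by rewrite big1 // => i _; rewrite none.
rewrite (bigD1 i) //= ei big1 // => j ji.
apply/eqP; rewrite eqb0; apply/negP => ej.
case: (ltngtP i j) => [ij|ij|/ord_inj ij].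
- exact: lt_absurd ij ei ej.
- exact: lt_absurd ij ej ei.
- by rewrite ij eqxx in ji.
Qed.

                                                                             
                                                                              
                                                                   
(** The sequence has three states, B, C and neither, and the sum counts steps from B to C minus
    steps from C to B. The former enter the cyclic interval C and the latter leave it, each at most
    once. *)
Lemma winding_le1 (B C : 'I_n -> bool) : not_interleaved C ->
    (forall i, ~~ (B i && C i)) ->
  `|\sum_(i < n) ((B i && C (ordS i))%:R - (C i && B (ordS i))%:R)| <= 1 :> int.
Proof.
move=> Cint BC; rewrite sumrB.
have entries : \sum_(i < n) (B i && C (ordS i))%:R <= 1 :> int.
  apply: (@le_trans _ _ (\sum_(i < n) (~~ C i && C (ordS i))%N%:R)).
    apply: ler_sum => i _; rewrite ler_nat; have := BC i.
    by case: (B i); case: (C i); case: (C _).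
  by rewrite -natr_sum (ler_nat _ _ 1); exact: single_entry.
have exits : \sum_(i < n) (C i && B (ordS i))%:R <= 1 :> int.
  apply: (@le_trans _ _ (\sum_(i < n) (~~ ~~ C i && ~~ C (ordS i))%N%:R)).
    apply: ler_sum => i _; rewrite ler_nat; have := BC (ordS i).
    by case: (B _); case: (C i); case: (C _).
  by rewrite -natr_sum (ler_nat _ _ 1); apply: (single_entry (not_interleavedC Cint)).
have p1 : 0 <= \sum_(i < n) (B i && C (ordS i))%:R :> int.
  by apply: sumr_ge0 => i _; exact: ler0n.
have p2 : 0 <= \sum_(i < n) (C i && B (ordS i))%:R :> int.
  by apply: sumr_ge0 => i _; exact: ler0n.
by rewrite ler_norml; apply/andP; split; lra.
Qed.

End CyclicIntervals.

(** * The discrete Stokes formula and the area bound *)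

Section Stokes.
Variables (M : fine_surface) (n : nat) (o : 'I_n -> bool).
Local Notation C := (cycle_graph o).
Variables (fV : vertex C -> vertex (skeleton M)) (fE : edge C -> edge (skeleton M)).
Hypothesis iso : boundary_iso fV fE.
Hypothesis trivM : cocycles_trivial M.
Hypothesis fV_reachable : forall i j, reachable (fV i) (fV j).

Lemma pi_side_src (s : side M) :
  @src (skeleton M) (\pi_{eq_quot (@side_eqv M)} s) = flag_vertex (s, ord0).
Proof.
have /eqmodP rs : repr (\pi_{eq_quot (@side_eqv M)} s) = s %[mod {eq_quot (@side_eqv M)}].
  by rewrite reprK.
rewrite -[LHS]/(flag_vertex (repr (\pi_{eq_quot (@side_eqv M)} s), ord0)).
have /orP[/eqP sr|/eqP sr] : (s == repr (\pi_{eq_quot (@side_eqv M)} s)) ||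
    (s == glue (repr (\pi_{eq_quot (@side_eqv M)} s))) := rs.
  by rewrite -sr.
by rewrite -[LHS]cross_vertex /cross /= -sr.
Qed.

Lemma pi_side_tgt (s : side M) :
  @tgt (skeleton M) (\pi_{eq_quot (@side_eqv M)} s) = flag_vertex (s, ord_max).
Proof.
have /eqmodP rs : repr (\pi_{eq_quot (@side_eqv M)} s) = s %[mod {eq_quot (@side_eqv M)}].
  by rewrite reprK.
rewrite -[LHS]/(flag_vertex (repr (\pi_{eq_quot (@side_eqv M)} s), ord_max)).
have /orP[/eqP sr|/eqP sr] : (s == repr (\pi_{eq_quot (@side_eqv M)} s)) ||
    (s == glue (repr (\pi_{eq_quot (@side_eqv M)} s))) := rs.
  by rewrite -sr.
by rewrite -[LHS]cross_vertex /cross /= -sr.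
Qed.

(** Twice the signed area spanned by the origin and the image of [s] under (F, G); its signed sum
    over the sides of a triangle is dF ∧ dG on that triangle. *)
Definition exterior_product (F G : vertex (skeleton M) -> int) (s : side M) : int :=
  F (flag_vertex (s, ord0)) * G (flag_vertex (s, ord_max))
  - F (flag_vertex (s, ord_max)) * G (flag_vertex (s, ord0)).

Lemma stokes (F G : vertex (skeleton M) -> int) (eps : triangle M -> bool) (th : bool) :
    (forall s : side M, glue s != s ->
       eps s.1 (+) eps (glue s).1 = ~~ (middle s (+) middle (glue s))) ->
    (forall i : 'I_n, eps (boundary_side fE i).1 (+) middle (boundary_side fE i) = th (+) o i) ->
  \sum_t (-1) ^+ eps t * (\sum_(j < 3) (-1) ^+ (middle (t, j)) * exterior_product F G (t, j)) =
  (-1) ^+ (~~ th) * \sum_(j < n) (F (fV j) * G (fV (ordS j)) - F (fV (ordS j)) * G (fV j)).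
Proof.
move=> epsP epsB.
pose Psi (s : side M) := (-1) ^+ (eps s.1 (+) middle s) * exterior_product F G s.
have -> : \sum_t (-1) ^+ eps t * (\sum_(j < 3) (-1) ^+ (middle (t, j)) *
     exterior_product F G (t, j)) = \sum_s Psi s.
  under eq_bigr do rewrite mulr_sumr.
  rewrite pair_bigA /=; apply: eq_bigr => -[t j] _.
  by rewrite /Psi signr_addb mulrA.
rewrite (bigID (fun s => glue s == s)) /= [X in _ + X](_ : _ = 0) ?addr0; last first.
  apply: (big_int_involution (@glueK M)) => s; first by rewrite glueK eq_sym.
  move=> gs; rewrite /Psi -mulNr -signrN; congr (_ ^+ (nat_of_bool _) * _).
    have := epsP _ gs.
    by case: (eps _); case: (eps _); case: (middle _); case: (middle _).
  rewrite /exterior_product -[flag_vertex (glue s, ord0)]/(flag_vertex (cross (s, ord0))).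
  rewrite -[flag_vertex (glue s, ord_max)]/(flag_vertex (cross (s, ord_max))).
  by rewrite !cross_vertex.
transitivity (\sum_(s in [set boundary_side fE i | i : 'I_n]) Psi s).
  apply: eq_bigl => s; apply/eqP/imsetP => [/(boundary_side_onto iso)[i ->]|[i _ ->]].
    by exists i.
  exact: (boundary_side_fixed iso).
rewrite big_imset /=; last by move=> i j _ _; apply: (boundary_side_inj iso).
rewrite mulr_sumr; apply: eq_bigr => i _.
rewrite /Psi epsB /exterior_product (boundary_side_src iso) (boundary_side_tgt iso) /=.
by case: (o i); rewrite ?addbT ?addbF // ?signrN; ring.
Qed.

(** By [stokes] the double sum is, up to sign, a signed sum over the triangles, each contributing a
    winding number of absolute value at most 1. *)
Theorem boundary_sum_le_area :
  `|\sum_(i < n) \sum_(j < n)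
     ((ndist (fV i) (fV j))%:Z * (ndist (fV (ordS i)) (fV (ordS j)))%:Z
      - (ndist (fV i) (fV (ordS j)))%:Z * (ndist (fV (ordS i)) (fV j))%:Z)|
  <= (area M)%:Z.
Proof.
have [eps epsP] := orientable trivM.
have [th thP] := boundary_coherent iso epsP.
pose F (i : 'I_n) (v : vertex (skeleton M)) : int := (ndist (fV i) v)%:Z.
set S := \sum_(i < n) _.
pose W t := \sum_(i < n) \sum_(j < 3) (-1) ^+ (middle (t, j)) *
   exterior_product (F i) (F (ordS i)) (t, j).
have SE : \sum_t (-1) ^+ eps t * W t = (-1) ^+ (~~ th) * S.
  under eq_bigr do rewrite /W mulr_sumr.
  rewrite exchange_big /= /S mulr_sumr; apply: eq_bigr => i _.
  exact: (stokes (F i) (F (ordS i)) epsP thP).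
have -> : `|S| = `|\sum_t (-1) ^+ eps t * W t| by rewrite SE normrMsign.
apply: (le_trans (ler_norm_sum _ _ _)).
rewrite /area -sum1_card -[leRHS]natz natr_sum; apply: ler_sum => t _.
rewrite normrMsign.
pose e (j : 'I_3) : edge (skeleton M) := \pi_{eq_quot (@side_eqv M)} (t, j).
pose B i := farther fV (e ord_max) i.
pose D i := farther fV (e ord0) i.
pose x i := F i (flag_vertex ((t, ord_max), ord0)).
pose y i := F i (flag_vertex ((t, ord0), ord0)).
pose z i := F i (flag_vertex ((t, ord0), ord_max)).
have vE (s s' : 'I_3) (k k' : 'I_2) : lift s k = lift s' k' ->
    flag_vertex ((t, s), k) = flag_vertex ((t, s'), k').
  by move=> sk; rewrite /flag_vertex /flag_corner /side_end /= sk.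
have yE : flag_vertex ((t, ord_max), ord_max) = flag_vertex ((t, ord0), ord0).
  by apply: vE; apply: val_inj.
have x'E : flag_vertex ((t, lift ord0 ord0), ord0) = flag_vertex ((t, ord_max), ord0).
  by apply: vE; apply: val_inj.
have z'E : flag_vertex ((t, lift ord0 ord0), ord_max) = flag_vertex ((t, ord0), ord_max).
  by apply: vE; apply: val_inj.
have yB i : y i = x i + (B i)%:R.
  have := ndist_edge (fV i) (e ord_max); rewrite /y /x /B /F -yE /farther.
  rewrite pi_side_src pi_side_tgt.
  by case: eqP => /=; lia.
have zD i : z i = y i + (D i)%:R.
  have := ndist_edge (fV i) (e ord0); rewrite /z /y /D /F /farther.
  rewrite pi_side_src pi_side_tgt.
  by case: eqP => /=; lia.
(* The edge from vertex 0 to vertex 2 of the triangle also has length 1, so the distance grows at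
   most once along 0, 1, 2. *)
have BD i : ~~ (B i && D i).
  have := ndist_edge (fV i) (e (lift ord0 ord0)).
  rewrite pi_side_src pi_side_tgt x'E z'E.
  have := yB i; have := zD i; rewrite /x /y /z /F.
  by case: (B i); case: (D i) => //=; lia.
(* The three exterior products combine into the determinant of the increments of F_i and F_{i+1}. *)
have Wdet : W t = \sum_(i < n) ((B i && D (ordS i))%:R - (D i && B (ordS i))%:R).
  rewrite /W; apply: eq_bigr => i _.
  rewrite !big_ord_recl big_ord0 /exterior_product.
  have -> : lift ord0 (lift ord0 ord0) = ord_max :> 'I_3 by apply: val_inj.
  rewrite yE x'E z'E -!/(x _) -!/(y _) -!/(z _).
  have m0 : middle (t, ord0) = false by rewrite /middle /= -val_eqE /= inordK.
  have m1 : middle (t, lift ord0 ord0) = true by rewrite /middle /= -val_eqE /= inordK.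
  have m2 : middle (t, ord_max) = false by rewrite /middle /= -val_eqE /= inordK.
  rewrite m0 m1 m2 !zD !yB -!mulnb !natrM; ring.
rewrite Wdet; apply: winding_le1 => // i1 i2 i3 i4.
exact: farther_not_interleaved iso trivM fV_reachable _ _ _ _ _.
Qed.

End Stokes.

                       

Lemma lipschitz_ndist (G : fine_graph) (phi : vertex G -> int) :
    (forall e, phi (src e) <= phi (tgt e) <= phi (src e) + 1) ->
  forall x y, reachable x y -> phi y - phi x <= (ndist x y)%:Z.
Proof.
move=> lip x y /ndist_geodesic[p wp <-].
elim: p x wp => [|d p IH] x /=; first by move=> ->; rewrite subrr.
move=> [-> /IH wp]; rewrite /walk_length big_cons PoszD -/(walk_length p).
have dl : phi (dart_tgt d) - phi (dart_src d) <= (dart_length d)%:Z.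
  by case: d {wp} => e [] /=; have /andP[] := lip e; rewrite /dart_src /dart_tgt /dart_length /=; lia.
lia.
Qed.

(** * Distances along a fine cycle and the value of the boundary sum *)

Section CycleDistance.
Variables (a b n : nat) (o : 'I_n -> bool).
Hypothesis cycleC : is_fine_cycle a b o.
Local Notation C := (cycle_graph o).

Let n_gt0 : (0 < n)%N. Proof. by case: cycleC. Qed.

Definition cyc (k : nat) : 'I_n := Ordinal (ltn_pmod k n_gt0).

Definition up (k : nat) : int := (o (cyc k))%:R.

Definition height (k : nat) : int := \sum_(0 <= l < k) up l.

Lemma heightS k : height k.+1 = height k + up k.
Proof. by rewrite /height big_nat_recr. Qed.

Lemma up01 k : up k = 0 \/ up k = 1.
Proof. by rewrite /up; case: (o _); [right|left]. Qed.

Lemma cyc_ord (i : 'I_n) : cyc i = i.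
Proof. by apply: val_inj; rewrite /= modn_small. Qed.

Lemma cycS k : ordS (cyc k) = cyc k.+1.
Proof. by apply: val_inj; rewrite /= -addn1 modnDml addn1. Qed.

Lemma cycDn k : cyc (k + n) = cyc k.
Proof. by apply: val_inj; rewrite /= modnDr. Qed.

Lemma cyc_add_inj k : injective (fun d : 'I_n => cyc (k + d)).
Proof.
move=> d d' /(congr1 val) /eqP; rewrite /= eqn_modDl !modn_small // => /eqP.
exact: val_inj.
Qed.

Lemma sum_cyc (f : 'I_n -> int) k : \sum_(j < n) f j = \sum_(d < n) f (cyc (k + d)).
Proof. exact: (reindex_inj (@cyc_add_inj k)). Qed.

Lemma sum_up k : \sum_(d < n) up (k + d) = a%:Z.
Proof.
rewrite -(sum_cyc (fun j => (o j)%:R)).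
have [_ <- _] := cycleC; rewrite /walk_length /cycle_walk big_map big_enum /=.
rewrite -[RHS]natz natr_sum; apply: eq_bigr => i _.
by rewrite /dart_length /=; case: (o i).
Qed.

Lemma n_eq : n = (a + b)%N.
Proof.
have [_ <- <-] := cycleC; rewrite /cycle_rev_walk /walk_length.
rewrite (perm_big _ (permEl (perm_rev _))) /cycle_walk big_map big_enum big_map big_map big_enum /=.
rewrite -big_split /= -[LHS]card_ord -sum1_card; apply: eq_bigr => i _.
by rewrite /dart_length /=; case: (o i).
Qed.

Lemma heightDn k : height (k + n) = height k + a%:Z.
Proof.
rewrite -(sum_up k) /height (big_cat_nat _ (n := k)) //=; last exact: leq_addr.
congr (_ + _); rewrite -{1}[k]add0n big_addn addKn big_mkord.
by apply: eq_bigr => d _; rewrite addnC.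
Qed.

Lemma reachable_cyc k d : @reachable C (cyc k) (cyc (k + d)).
Proof.
elim: d => [|d IH]; first by rewrite addn0; exact: reachable_refl.
apply: reachable_trans IH _; rewrite addnS -cycS.
have := @reachable_edge C (cyc (k + d)); rewrite /=.
by case: (o _) => // /reachable_sym.
Qed.

Lemma reachable_cycle (i j : 'I_n) : @reachable C i j.
Proof.
rewrite -(cyc_ord i) -(cyc_ord j).
have -> : cyc j = cyc (i + (j + (n - i))).
  by rewrite addnCA subnKC 1?ltnW // cycDn.
exact: reachable_cyc.
Qed.

Lemma ndist_cyc_step x k :
  (@ndist C x (cyc k.+1))%:Z <= (@ndist C x (cyc k))%:Z + up k /\
  (@ndist C x (cyc k))%:Z <= (@ndist C x (cyc k.+1))%:Z + (1 - up k).
Proof.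
rewrite -cycS /up; have := @ndist_edge C x (cyc k); rewrite /=.
by case: (o _) => /=; lia.
Qed.

                                                                                
                                                                              
(** The forward arc of [d] edges costs its number c of upward edges; the backward arc costs the
    downward edges among the other n - d, namely c + b - d. The minimum of the two is c minus the
    truncated difference d - b. *)
Definition cycle_dist (k d : nat) : int := height (k + d) - height k - (d - b)%N%:Z.

Lemma ndist_cyc_le k d : (d <= n)%N ->
  (@ndist C (cyc k) (cyc (k + d)))%:Z <= cycle_dist k d.
Proof.
move=> dn; have [db|bd] := leqP d b.
  rewrite /cycle_dist (eqP db) subr0; elim: d {dn db} => [|d IH].
    by rewrite addn0 subrr ndistxx.
  have [+ _] := ndist_cyc_step (cyc k) (k + d).
  by rewrite addnS heightS; lia.
(* Backward arc: going back over [m] edges from [k + n] costs the number of downward ones among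
   them. *)
have : forall m, (m <= n)%N -> (@ndist C (cyc k) (cyc (k + (n - m))))%:Z <=
    m%:Z - (height (k + n) - height (k + (n - m))).
  elim=> [|m IH] mn; first by rewrite subn0 subrr cycDn ndistxx.
  have [_] := ndist_cyc_step (cyc k) (k + (n - m.+1)).
  have := heightS (k + (n - m.+1)); have := IH (ltnW mn).
  have -> : (k + (n - m) = (k + (n - m.+1)).+1)%N by lia.
  by lia.
move=> /(_ (n - d)%N (leq_subr _ _)); rewrite subKn // heightDn /cycle_dist.
have := n_eq; lia.
Qed.

Lemma cycle_distS k d :
  cycle_dist k d.+1 = cycle_dist k d + up (k + d) - (b <= d)%N%:Z.
Proof. by rewrite /cycle_dist addnS heightS; case: leqP; lia. Qed.

Lemma cycle_dist0 k : cycle_dist k 0 = 0.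
Proof. by rewrite /cycle_dist addn0 sub0n subrr. Qed.

Lemma cycle_distn k : cycle_dist k n = 0.
Proof. by rewrite /cycle_dist heightDn; have := n_eq; lia. Qed.

(** For the lower bound, [cycle_dist k] descends to the cycle, since it vanishes at 0 and at [n],
    and it grows by 0 or 1 along each oriented edge; such a function bounds distances from below. *)
Lemma ndist_cyc k d : (d <= n)%N -> (@ndist C (cyc k) (cyc (k + d)))%:Z = cycle_dist k d.
Proof.
move=> dn; apply/eqP; rewrite eq_le ndist_cyc_le //=.
pose gap (v : 'I_n) : nat := ((v + (n - k %% n)) %% n)%N.
have kn : (k %% n < n)%N by rewrite ltn_pmod.
have gapK (v : 'I_n) : cyc (k + gap v) = v.
  apply: val_inj; rewrite /= /gap modnDmr -modnDml addnCA subnKC 1?ltnW //.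
  by rewrite modnDr modn_small.
have gap_cyc e : (e < n)%N -> gap (cyc (k + e)) = e.
  move=> en; have gl : (gap (cyc (k + e)) < n)%N by rewrite ltn_pmod.
  have := gapK (cyc (k + e)).
  by move=> /(@cyc_add_inj k (Ordinal gl) (Ordinal en)) [].
pose phi (v : vertex C) : int := cycle_dist k (gap v).
have phiE g : (g < n)%N -> phi (cyc (k + g)) = cycle_dist k g.
  by move=> gn; rewrite /phi gap_cyc.
have phiS g : (g < n)%N -> phi (ordS (cyc (k + g))) = cycle_dist k g.+1.
  move=> gn; rewrite cycS -addnS; move: gn; rewrite leq_eqVlt => /orP[/eqP gn|gn].
    by rewrite gn cycDn cycle_distn -[k in cyc k]addn0 phiE // cycle_dist0.
  exact: phiE.
have lip (e : edge C) : phi (src e) <= phi (tgt e) <= phi (src e) + 1.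
  have gl : (gap e < n)%N by rewrite ltn_pmod.
  have := phiS _ gl; have := phiE _ gl; rewrite cycle_distS /up gapK /=.
  by case: (o e) => /= -> ->; case: (b <= _)%N; lia.
have phik : phi (cyc k) = 0 by rewrite /phi -[k in cyc k]addn0 gap_cyc // cycle_dist0.
have := lipschitz_ndist lip (reachable_cyc k d); rewrite phik subr0.
apply: le_trans; rewrite /phi.
have [dltn|] := ltnP d n; first by rewrite gap_cyc.
move=> nd; have -> : d = n by apply/eqP; rewrite eqn_leq dn nd.
by rewrite cycle_distn cycDn -[k in cyc k]addn0 gap_cyc // cycle_dist0.
Qed.

Lemma sum_height_shift m : \sum_(i < n) (height (i + m) - height i) = m%:Z * a%:Z.
Proof.
elim: m => [|m IH].
  by rewrite mul0r big1 // => i _; rewrite addn0 subrr.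
have -> : \sum_(i < n) (height (i + m.+1) - height i) =
    \sum_(i < n) (height (i + m) - height i) + \sum_(i < n) up (m + i).
  rewrite -big_split /=; apply: eq_bigr => i _.
  by rewrite addnS heightS addrAC [(m + i)%N]addnC.
by rewrite IH sum_up; lia.
Qed.

Hypothesis a_gt0 : (0 < a)%N.
Hypothesis b_gt0 : (0 < b)%N.

                                                    
(** The minor of the distance matrix on rows i, i+1 and columns i+d, i+d+1. For d = 0 it involves
    the distance from i+1 back to i, which is 1 - [up i]. *)
Definition minor (i d : nat) : int :=
  cycle_dist i d * cycle_dist i.+1 d -
  cycle_dist i d.+1 * (if d is d'.+1 then cycle_dist i.+1 d' else 1 - up i).

Definition climb (i d : nat) : int := height (i + d) - height i.

Lemma climbS i d : climb i d.+1 = climb i d + up (i + d).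
Proof. by rewrite /climb addnS heightS addrAC. Qed.

Lemma climb0 i : climb i 0 = 0.
Proof. by rewrite /climb addn0 subrr. Qed.

Lemma climb_succ i d : climb i.+1 d = climb i d.+1 - up i.
Proof. by rewrite /climb heightS addSnnS opprD addrA. Qed.

Lemma cycle_distE i d : cycle_dist i d = climb i d - (d - b)%N%:Z.
Proof. by []. Qed.

Lemma minor0 i : minor i 0 = 0.
Proof.
rewrite /minor cycle_dist0 mul0r cycle_distE climbS climb0 addn0 !add0r.
have -> : (1 - b = 0)%N by lia.
by case: (up01 i) => ->.
Qed.

(** On either side of d = b the formula for distances has a single form, forward or backward, and
    the minor reduces to a product of two edge costs in that direction; d = b itself is
    exceptional. *)
Lemma minor_lt i d : (d.+1 < b)%N -> minor i d.+1 = up i * up (i + d.+1).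
Proof.
move=> db; rewrite /minor !cycle_distE !climb_succ !climbS.
have -> : (d.+1 - b = 0)%N by lia.
have -> : (d.+2 - b = 0)%N by lia.
have -> : (d - b = 0)%N by lia.
ring.
Qed.

Lemma minor_eq i : minor i b = up i * up (i + b) + climb i b - up i.
Proof.
rewrite -(prednK b_gt0); set d := b.-1; have dE : d.+1 = b by rewrite prednK.
rewrite /minor !cycle_distE !climb_succ !climbS.
have -> : (d.+1 - b = 0)%N by lia.
have -> : (d.+2 - b = 1)%N by lia.
have -> : (d - b = 0)%N by lia.
case: (up01 i) => ->; ring.
Qed.

Lemma minor_gt i m : minor i (b + m).+1 = (1 - up i) * (1 - up (i + (b + m).+1)).
Proof.
rewrite /minor !cycle_distE !climb_succ !climbS.
have -> : ((b + m).+1 - b = m + 1)%N by lia.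
have -> : ((b + m).+2 - b = m + 2)%N by lia.
have -> : (b + m - b = m)%N by lia.
rewrite !PoszD; ring.
Qed.

Lemma sum_minor_le i k : (k < b)%N ->
  \sum_(d < k.+1) minor i d = up i * climb i k.+1 - up i.
Proof.
elim: k => [|k IH] kb.
  rewrite big_ord1 minor0 climbS climb0 addn0 add0r.
  by case: (up01 i) => ->.
by rewrite big_ord_recr /= IH 1?ltnW // minor_lt // [in RHS]climbS; ring.
Qed.

Lemma sum_minor_gt i m : \sum_(d < (b + m).+1) minor i d =
  up i * climb i b.+1 - 2 * up i + climb i b
  + (1 - up i) * (m%:Z - climb i (b + m).+1 + climb i b.+1).
Proof.
elim: m => [|m IH].
  have low := @sum_minor_le i b.-1; rewrite prednK // in low.
  rewrite addn0 big_ord_recr /= low // minor_eq climbS; ring.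
rewrite addnS big_ord_recr /= IH minor_gt [climb i (b + m).+2]climbS.
rewrite -[m.+1]addn1 PoszD; ring.
Qed.

(** Row i sums to climb(b) + climb(b+1) - up - 1. Over all rows a climb of m steps totals ma, giving
    ab + a(b+1) - a - (a+b). *)
Lemma sum_minor : \sum_(i < n) \sum_(d < n) minor i d =
  2 * a%:Z * b%:Z - a%:Z - b%:Z.
Proof.
transitivity (\sum_(i < n) (climb i b + climb i b.+1 - up i - 1)).
  apply: eq_bigr => i _.
  have nE : n = (b + a.-1).+1 by rewrite n_eq; lia.
  have := sum_minor_gt i a.-1; rewrite -nE => ->.
  have -> : climb i n = a%:Z by rewrite /climb heightDn; lia.
  have -> : a.-1%:Z = a%:Z - 1 by lia.
  ring.
have upE : \sum_(i < n) up i = a%:Z by rewrite -(sum_up 0).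
rewrite !sumrB big_split /= !sum_height_shift upE sumr_const card_ord natz.
by rewrite n_eq; lia.
Qed.

Theorem cycle_boundary_sum :
  \sum_(i < n) \sum_(j < n)
     ((@ndist C i j)%:Z * (@ndist C (ordS i) (ordS j))%:Z
      - (@ndist C i (ordS j))%:Z * (@ndist C (ordS i) j)%:Z) =
  2 * a%:Z * b%:Z - a%:Z - b%:Z.
Proof.
rewrite -sum_minor; apply: eq_bigr => i _.
rewrite [LHS](sum_cyc _ i); apply: eq_bigr => d _.
have D0 (k e : nat) : (e <= n)%N -> (@ndist C (cyc k) (cyc (k + e)))%:Z = cycle_dist k e.
  exact: ndist_cyc.
have iE : cyc i = i by exact: cyc_ord.
have SiE : ordS i = cyc i.+1 by rewrite -cycS iE.
have dn := ltn_ord d.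
have e1 : (@ndist C i (cyc (i + d)))%:Z = cycle_dist i d.
  by rewrite -D0 ?(ltnW dn) // iE.
have e2 : (@ndist C (ordS i) (ordS (cyc (i + d))))%:Z = cycle_dist i.+1 d.
  by rewrite SiE cycS -addSn D0 // ltnW.
have e3 : (@ndist C i (ordS (cyc (i + d))))%:Z = cycle_dist i d.+1.
  by rewrite cycS -addnS -D0 // iE.
rewrite e1 e2 e3 SiE /minor {e1 e2 e3}.
case: (nat_of_ord d) dn => [_|e en]; last first.
  by rewrite -addSnnS D0 // ltnW // ltnW.
rewrite addn0; congr (_ - _ * _).
(* The vertex before i+1 is reached by n - 1 forward steps; that distance is the d = 0 entry in
   [minor]. *)
have -> : cyc i = cyc (i.+1 + n.-1) by rewrite addSnnS prednK // cycDn.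
rewrite D0 ?leq_pred // cycle_distE /climb heightS addSnnS prednK // heightDn.
by have := n_eq; lia.
Qed.

End CycleDistance.

Theorem theorem13p4 (R : realType) (M : fine_surface)
    (a b n : nat) (o : 'I_n -> bool)
    (diskM : homeomorphic (realization R M) (closed_disk R))
    (cycleC : is_fine_cycle a b o)
    (fillM : fills_isometrically M (cycle_graph o)) :
  2 * a%:Z * b%:Z - a%:Z - b%:Z <= (area M)%:Z.
Proof.
(* If [a] or [b] is 0 the claimed bound is not positive. *)
have [a0|a_gt0] := posnP a; first by rewrite a0; lia.
have [b0|b_gt0] := posnP b; first by rewrite b0; lia.
have trivM : cocycles_trivial M by exact: (locally_trivial_cocycle_trivial diskM).
have [fV [fE [iso fV_dist]]] := fillM.
have reachC := reachable_cycle cycleC.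
have fV_reachable i j : reachable (fV i) (fV j).
  by apply: dist_Some; rewrite fV_dist; exact: dist_reachable (reachC i j).
have := boundary_sum_le_area iso trivM fV_reachable.
apply: le_trans; apply: le_trans (ler_norm _).
rewrite -(cycle_boundary_sum cycleC a_gt0 b_gt0) /ndist.
by apply: ler_sum => i _; apply: ler_sum => j _; rewrite !fV_dist.
Qed.
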